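(* The following algorithm is a $4$-approximation for the unrestricted MV-mTSP$_+$ with arbitrary tours, and it runs in time polynomial in $n$, $m$ and $\log r(V)$. (That is, on every instance $(G,c,r,m)$ it returns NO if no feasible solution exists, and otherwise returns a feasible solution $X$ with $\operatorname{cost}(X)\leq 4\cdot\mathsf{OPT}$, where $\mathsf{OPT}$ is the minimum cost of a feasible solution.) Algorithm. (1) If $m>r(V)$, return NO. (2) If $m>n$, then for each $v\in V$ add $r(v)$ copies of the self-loop $vv$ to $X$; take a partition $X=X_1\cup\dots\cup X_m$ into $m$ non-empty sets such that each $X_i$ contains copies of one and the same self-loop, and return $X=X_1\cup\dots\cup X_m$. (3) Determine a minimum cost spanning forest $F$ of $G$ consisting of $m$ components, and let $F_1,\dots,F_m$ be its components. (4) For $i=1,\dots,m$: if $|V(F_i)|\geq 2$, let $H_i$ be the cycle on $V(F_i)$ obtained by duplicating the edges of $F_i$ and applying shortcuts; otherwise let $H_i$ consist of a single copy of the self-loop on the vertex in $V(F_i)$. (5) For each $v\in V$, pick an index $i$ with $v\in V(H_i)$ and add $r(v)-1$ copies of the self-loop $vv$ to $H_i$. Denote the resulting multigraphs by $X_i$, $i=1,\dots,m$, and return $X=X_1\cup\dots\cup X_m$.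
   Context: Instance: a finite vertex set $V$ with $n=|V|$; $G=(V,E)$ is the complete undirected graph on $V$, including a self-loop $vv$ at each $v$; symmetric costs $c(uv)\geq 0$ (self-loop costs $c(vv)$ are not assumed to be zero) that are metric: $c(uw)\leq c(uv)+c(vw)$ for all $u,v,w\in V$, and $c(vv)\leq 2\min_{u\in V\setminus\{v\}}c(uv)$ for all $v\in V$; requests $r:V\to\mathbb{Z}_{\geq 1}$ (encoded in binary), with $r(V)=\sum_{v\in V} r(v)$; an integer $m\geq 1$ (number of agents). A multigraph is a multiset $X$ of edges (self-loops allowed) on $V$; $\operatorname{cost}(X)=\sum_{uv} x(uv)c(uv)$, where $x(uv)$ is the multiplicity of $uv$ in $X$. The degree $\dot\delta_X(v)$ counts each copy of the self-loop $vv$ twice. An MVTSP tour is a connected multigraph in which every degree is even (the edge multiset of a closed walk); a multigraph with even degrees visits $v$ exactly $\dot\delta_X(v)/2$ times. An isolated vertex without a self-loop counts as no visit. A tour is non-empty if it has at least one edge. Unrestricted MV-mTSP$_+$ with arbitrary tours: find a minimum-cost multigraph $X$ visiting each $v\in V$ exactly $r(v)$ times whose edge multiset can be partitioned into exactly $m$ non-empty, not necessarily vertex-disjoint, MVTSP tours $X_1,\dots,X_m$. Multigraphs are represented compactly, by storing each edge together with its multiplicity in binary. Duplicating the edges of a tree and applying shortcuts means: take a closed Eulerian walk of the tree with all edges doubled and skip repeated vertices, obtaining a cycle through all its vertices (on two vertices, the cycle consists of two parallel edges). *)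

(* Defs.v *)
From mathcomp Require Import all_boot all_order all_algebra.

Set Implicit Arguments.
Unset Strict Implicit.
Unset Printing Implicit Defensive.

Import Order.TTheory GRing.Theory Num.Theory.

(* An edge is the unordered set of its endpoints: {u, v}, or {v} for the
   self-loop at v.  Functions of edges are therefore symmetric. *)
Definition edge (V : finType) := {e : {set V} | 0 < #|e| <= 2}.

Lemma edge_proof (V : finType) (u v : V) : 0 < #|[set u; v]| <= 2.
Proof. by rewrite cards2; case: (u != v). Qed.

Definition uv (V : finType) (u v : V) : edge V :=
  exist (fun e : {set V} => 0 < #|e| <= 2) [set u; v] (edge_proof u v).

Definition loop (V : finType) (v : V) : edge V := uv v v.

Section Multigraphs.

Variable V : finType.

Definition multigraph := {ffun edge V -> nat}.

Definition degree (X : multigraph) (v : V) : nat :=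
  \sum_(e : edge V | v \in val e) (if e == loop v then 2 else 1) * X e.

Definition visits (X : multigraph) (v : V) : nat := (degree X v)./2.

Definition vertices (X : multigraph) : {set V} := [set v | 0 < degree X v].

Definition adj (X : multigraph) : rel V := [rel u v | 0 < X (uv u v)].

Definition tour (X : multigraph) : Prop :=
  (forall v, ~~ odd (degree X v)) /\
  {in vertices X &, forall u v, connect (adj X) u v}.

Definition nonempty (X : multigraph) : Prop := exists e, 0 < X e.

Definition munion (m : nat) (Xs : 'I_m -> multigraph) : multigraph :=
  [ffun e => \sum_(i < m) Xs i e].

(* The edges of the closed walk w_0, w_1, ..., w_(k-1), w_0. *)
Definition walk_edges (w : seq V) : seq (edge V) :=
  [seq uv p.1 p.2 | p <- zip w (rot 1 w)].

Definition walk_graph (w : seq V) : multigraph :=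
  [ffun e => count_mem e (walk_edges w)].

Definition doubled (T : {set edge V}) : multigraph :=
  [ffun e => 2 * (e \in T)].

(* [undup] keeps last occurrences; a shortcut walk keeps first ones. *)
Definition shortcut (w : seq V) : seq V := rev (undup (rev w)).

Definition fadj (F : {set edge V}) : rel V := [rel u v | uv u v \in F].

(* F has no parallel edges, so a closed vertex sequence of length 2 without
   repetition runs along one edge and back and is not a cycle; length 1 is
   a self-loop. *)
Definition forest (F : {set edge V}) : Prop :=
  forall s : seq V, uniq s -> cycle (fadj F) s -> size s \in [:: 0; 2].

Definition components (F : {set edge V}) : {set {set V}} :=
  [set [set u | connect (fadj F) v u] | v in [set: V]].

Definition edges_in (F : {set edge V}) (W : {set V}) : {set edge V} :=
  [set e in F | val e \subset W].

End Multigraphs.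

Local Open Scope ring_scope.

Record instance (R : realFieldType) (V : finType) := Instance {
  cost_of : edge V -> R;
  request : V -> nat;
  agents : nat;
  cost_of_ge0 : forall e, 0 <= cost_of e;
  cost_of_metric : forall u v w,
    cost_of (uv u w) <= cost_of (uv u v) + cost_of (uv v w);
  cost_of_loop : forall u v, u != v -> cost_of (loop v) <= 2 * cost_of (uv u v);
  request_ge1 : forall v, (1 <= request v)%N;
  agents_ge1 : (1 <= agents)%N
}.

Section Problem.

Variables (R : realFieldType) (V : finType) (I : instance R V).

Local Notation m := (agents I).

Definition total_request : nat := (\sum_(v : V) request I v)%N.

Definition cost (X : multigraph V) : R := \sum_(e : edge V) cost_of I e *+ X e.

Definition feasible (X : multigraph V) : Prop :=
  (forall v, visits X v = request I v) /\
  exists Xs : 'I_m -> multigraph V,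
    X = munion Xs /\ forall i, tour (Xs i) /\ nonempty (Xs i).

Definition is_OPT (o : R) : Prop :=
  (exists X, feasible X /\ cost X = o) /\ forall X, feasible X -> o <= cost X.

(* An outcome is [None] for NO, or the tours X_1, ..., X_m whose union X is
   returned. *)
Definition outcome := option ('I_m -> multigraph V).

Definition approximates (rho : R) (out : outcome) : Prop :=
  ((~ exists Y, feasible Y) -> out = None) /\
  ((exists Y, feasible Y) ->
     exists Xs, [/\ out = Some Xs, feasible (munion Xs)
       & exists o, is_OPT o /\ cost (munion Xs) <= rho * o]).

Definition forest_cost (F : {set edge V}) : R := \sum_(e in F) cost_of I e.

Definition spanning_forest (F : {set edge V}) : Prop :=
  forest F /\ #|components F| = m.

Definition min_spanning_forest (F : {set edge V}) : Prop :=
  spanning_forest F /\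
  forall F', spanning_forest F' -> forest_cost F <= forest_cost F'.

Definition split_loops (Xs : 'I_m -> multigraph V) : Prop :=
  munion Xs =
    [ffun e => \sum_(v : V) (if e == loop v then request I v else 0)]%N /\
  forall i, nonempty (Xs i) /\
    exists v, forall e, (0 < Xs i e)%N -> e = loop v.

(* T and W are the edge set and the vertex set of a component of F. *)
Definition cycle_of (T : {set edge V}) (W : {set V}) (H : multigraph V) : Prop :=
  if (2 <= #|W|)%N then
    exists w, walk_graph w = doubled T /\ H = walk_graph (shortcut w)
  else exists v, W = [set v] /\ H = [ffun e => nat_of_bool (e == loop v)].

Definition add_loops (H : 'I_m -> multigraph V) (pick : V -> 'I_m) (i : 'I_m) :
    multigraph V :=
  [ffun e => H i e +
     \sum_(v | pick v == i) (if e == loop v then request I v - 1 else 0)]%N.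

(* The possible outcomes of the algorithm, over all of its free choices: the
   partition of the self-loops, the forest, the numbering of its components,
   the Eulerian walks and the indices picked. *)
Inductive algorithm : outcome -> Prop :=
| Alg_no :
    (total_request < m)%N -> algorithm None
| Alg_loops (Xs : 'I_m -> multigraph V) :
    (m <= total_request)%N -> (#|V| < m)%N ->
    split_loops Xs -> algorithm (Some Xs)
| Alg_forest (F : {set edge V}) (W : 'I_m -> {set V})
    (H : 'I_m -> multigraph V) (pick : V -> 'I_m) :
    (m <= total_request)%N -> (m <= #|V|)%N ->
    min_spanning_forest F ->
    injective W -> W @: [set: 'I_m] = components F ->
    (forall i, cycle_of (edges_in F (W i)) (W i) (H i)) ->
    (forall v, v \in vertices (H (pick v))) ->
    algorithm (Some (add_loops H pick)).

End Problem.

Local Close Scope ring_scope.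

(* Running times are measured on a random access machine with structured
   programs, natural numbers of unbounded size, and the logarithmic cost
   criterion: an operation costs the number of bits of the numbers and
   addresses it handles (multiplication: the product of the operand lengths).
   The edge costs are elements of an arbitrary ordered field, and a program can
   only compare two of them, through [CostLe]. *)

Definition blen (k : nat) : nat := (trunc_log 2 k).+1.

Inductive binop := Add | Sub | Mul | Leq.

Inductive expr :=
| Num of nat
| Cell of nat & expr
| Op of binop & expr & expr
| CostLe of expr & expr & expr & expr.

Inductive prog :=
| Skip
| Assign of nat & expr & expr
| Seq of prog & prog
| If of expr & prog & prog
| While of expr & prog.

(* [s a i] is the content of cell i of the array a. *)
Definition memory := nat -> nat -> nat.

Definition update (s : memory) (a i k : nat) : memory :=
  fun b j => if (b == a) && (j == i) then k else s b j.

Definition eval_op (o : binop) (x y : nat) : nat :=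
  match o with
  | Add => x + y
  | Sub => x - y
  | Mul => x * y
  | Leq => x <= y
  end.

Definition op_time (o : binop) (x y : nat) : nat :=
  match o with
  | Mul => blen x * blen y
  | _ => blen x + blen y
  end.

Section Machine.

(* [cle i j k l] tells whether c(ij) <= c(kl), with vertices given by number. *)
Variable cle : nat -> nat -> nat -> nat -> bool.

Fixpoint eval (s : memory) (e : expr) : nat :=
  match e with
  | Num k => k
  | Cell a i => s a (eval s i)
  | Op o e1 e2 => eval_op o (eval s e1) (eval s e2)
  | CostLe e1 e2 e3 e4 => cle (eval s e1) (eval s e2) (eval s e3) (eval s e4)
  end.

Fixpoint eval_time (s : memory) (e : expr) : nat :=
  match e with
  | Num k => blen k
  | Cell a i => eval_time s i + blen (eval s i) + blen (s a (eval s i))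
  | Op o e1 e2 =>
      eval_time s e1 + eval_time s e2 + op_time o (eval s e1) (eval s e2)
  | CostLe e1 e2 e3 e4 =>
      eval_time s e1 + eval_time s e2 + eval_time s e3 + eval_time s e4 +
      blen (eval s e1) + blen (eval s e2) + blen (eval s e3) + blen (eval s e4)
  end.

(* [exec P s t s']: started in memory s, the program P halts in memory s'
   after time t. *)
Inductive exec : prog -> memory -> nat -> memory -> Prop :=
| Exec_skip s : exec Skip s 1 s
| Exec_assign a i e s :
    exec (Assign a i e) s
      (eval_time s i + eval_time s e + blen (eval s i) + blen (eval s e))
      (update s a (eval s i) (eval s e))
| Exec_seq P Q s t s' t' s'' :
    exec P s t s' -> exec Q s' t' s'' -> exec (Seq P Q) s (t + t') s''
| Exec_if_true e P Q s t s' :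
    eval s e != 0 -> exec P s t s' -> exec (If e P Q) s (eval_time s e + t) s'
| Exec_if_false e P Q s t s' :
    eval s e = 0 -> exec Q s t s' -> exec (If e P Q) s (eval_time s e + t) s'
| Exec_while_true e P s t s' t' s'' :
    eval s e != 0 -> exec P s t s' -> exec (While e P) s' t' s'' ->
    exec (While e P) s (eval_time s e + t + t') s''
| Exec_while_false e P s :
    eval s e = 0 -> exec (While e P) s (eval_time s e) s.

End Machine.

Section InputOutput.

Variables (R : realFieldType) (V : finType) (I : instance R V).

(* Vertices are numbered 0, ..., n-1 in the order of [enum V]. *)
Definition input_cle (i j k l : nat) : bool :=
  match onth (enum V) i, onth (enum V) j, onth (enum V) k, onth (enum V) l with
  | Some u, Some v, Some x, Some y =>
      (cost_of I (uv u v) <= cost_of I (uv x y))%R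
  | _, _, _, _ => false
  end.

(* Array 0 holds n and m, array 1 holds the requests. *)
Definition input : memory := fun a i =>
  match a with
  | 0 => nth 0 [:: #|V|; agents I] i
  | 1 => nth 0 [seq request I v | v <- enum V] i
  | _ => 0
  end.

(* Cell 0 of array 2 is 0 for NO and 1 for a solution; in the latter case
   arrays 3 and 4 hold the multiplicities in X and in X_1, ..., X_m. *)
Definition outputs (s : memory) (out : outcome I) : Prop :=
  match out with
  | None => s 2 0 = 0
  | Some Xs =>
      [/\ s 2 0 = 1,
          forall u v : V,
            s 3 (enum_rank u * #|V| + enum_rank v) = munion Xs (uv u v)
        & forall (i : 'I_(agents I)) (u v : V),
            s 4 ((i * #|V| + enum_rank u) * #|V| + enum_rank v) = Xs i (uv u v)]
  end.

End InputOutput.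

(* Main.v *)
(* Ratio.  In a feasible X every vertex v has degree 2 r(v), and a non-loop edge
   uv at v pays c(vv)/2 <= c(uv); hence r(v) self-loops at each v cost at most
   2 OPT in total.  The edges of X have at most m components, so they contain a
   spanning forest with m components and c(F) <= OPT; the shortcut cycles cost at
   most 2 c(F).  Together this is at most 4 OPT.

   Running time.  A program that never multiplies and whose loops are bounded by
   n or m makes polynomially many steps, each of which lengthens the numbers in
   memory by O(1) bits, so its logarithmic cost is polynomial.  Kruskal's
   algorithm with vertex labels is such a program; its forest is optimal because
   any edge set with fewer components crosses two components of the current
   forest.  The cycles come from adding the vertices of a component leaf by leaf:
   a leaf v attached to u is inserted after u in the cyclic order, which is the
   order in which an Eulerian walk with the detour u v u visits the vertices. *)

Require Import Defs.
From mathcomp Require Import all_boot all_order all_algebra zify.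
From Stdlib Require Import Classical.

Set Implicit Arguments.
Unset Strict Implicit.
Unset Printing Implicit Defensive.

Import Order.TTheory GRing.Theory Num.Theory.
Local Open Scope nat_scope.

Arguments uv {V} u v : simpl never.

(** * Components of edge sets *)

Section Edges.

Variable V : finType.
Implicit Types (u v x y : V) (e : edge V) (F G : {set edge V}).

(** Acyclicity never enters the optimality proof for Kruskal's algorithm: the invariant [greedy_opt]
    compares with all edge sets that have few enough components, and forests are recognised by the
    count edges + components = n. Multiplication is excluded because squaring in a loop doubles the
    bit length in every round. [poly_time] therefore separates N, a bound on loop counts, from B, a
    bound on bit lengths, and lets lengths grow only by a term free of B; over a loop such terms add
    up instead of compounding. The program never stores an Eulerian walk. Walks occur only in the
    invariant [grown]; the memory holds the successor function of the shortcut cycle, from which the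
    edge multiplicities are read off. The relation [algorithm] admits many outcomes, and the program
    has to realise just one. That the minimum OPT exists has to be proved, since costs lie in an
    arbitrary ordered field: feasible multiplicities are bounded, so there are finitely many
    candidates. *)

Lemma val_uv u v : val (uv u v) = [set u; v].
Proof. by []. Qed.

Lemma in_uv u v x : (x \in val (uv u v)) = (x == u) || (x == v).
Proof. by rewrite val_uv !inE. Qed.

Lemma uvC u v : uv u v = uv v u.
Proof. by apply: val_inj; rewrite !val_uv setUC. Qed.

Lemma uv_eq u v x y :
  (uv u v == uv x y) = (u == x) && (v == y) || (u == y) && (v == x).
Proof.
apply/eqP/idP => [E|]; last first.
  by case/orP=> /andP[/eqP-> /eqP->] //; apply: uvC.
have {}E z : (z \in val (uv u v)) = (z \in val (uv x y)) by rewrite E.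
have := E u; have := E v; have := E x; have := E y; rewrite !in_uv !eqxx !orbT /=.
rewrite (eq_sym x u) (eq_sym y u) (eq_sym x v) (eq_sym y v).
by do 4! case: eqP => ? //=; subst; rewrite ?eqxx.
Qed.

Lemma edgeP e : exists u v, e = uv u v.
Proof.
case: e => A A2; case/andP: (A2) => /card_gt0P[u uA] le2.
case: (set_0Vmem (A :\ u)) => [A0|[v]].
  exists u, u; apply: val_inj; rewrite val_uv /= -(setD1K uA) A0.
  by apply/setP=> x; rewrite !inE orbb orbF.
rewrite !inE => /andP[vu vA]; exists u, v; apply: val_inj; rewrite val_uv /=.
apply/eqP; rewrite eq_sym eqEcard cards2 eq_sym vu le2 andbT.
by apply/subsetP=> x; rewrite !inE => /orP[] /eqP->.
Qed.

Lemma eq_loop u v x : (uv u v == loop x) = (u == x) && (v == x).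
Proof. by rewrite uv_eq orbb. Qed.

Lemma fadjE F u v : fadj F u v = (uv u v \in F).
Proof. by []. Qed.

Lemma fadj_sym F : symmetric (fadj F).
Proof. by move=> u v; rewrite !fadjE uvC. Qed.

Lemma fconn_sym F : connect_sym (fadj F).
Proof. exact: sym_connect_sym (@fadj_sym F). Qed.

(** Kept abstract so that both the canonical [root] and the label array of Kruskal's algorithm
    qualify; components are then counted by the image of the labelling. *)
Definition labels F (lab : V -> V) :=
  forall u v, connect (fadj F) u v = (lab u == lab v).

Lemma labels_root F : labels F (fingraph.root (fadj F)).
Proof. by move=> u v; rewrite (root_connect (@fconn_sym F)). Qed.

Lemma connect_const F (T : Type) (g : V -> T) :
  (forall u v, uv u v \in F -> g u = g v) ->
  forall u v, connect (fadj F) u v -> g u = g v.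
Proof.
move=> gF u v /connectP[p]; elim: p u => [|w p IHp] u /=; first by move=> _ ->.
by case/andP=> /gF-> /IHp; apply.
Qed.

Lemma card_labels F lab : labels F lab -> #|components F| = #|lab @: [set: V]|.
Proof.
move=> labF; rewrite -(@card_in_imset _ _ (fun x => [set u | lab u == x])).
  rewrite -imset_comp; congr #|pred_of_set _|; apply: eq_imset => v /=.
  by apply/setP=> u; rewrite !inE labF eq_sym.
move=> _ _ /imsetP[u _ ->] /imsetP[v _ ->] /setP/(_ u).
by rewrite !inE eqxx => /esym/eqP.
Qed.

(** Roots of G are constant along the edges of F, so [g] factors through [f] and has no larger
    image. *)
Lemma leq_components F G :
  (forall u v, uv u v \in F -> connect (fadj G) u v) ->
  #|components G| <= #|components F|.
Proof.
set g := fingraph.root (fadj G); set f := fingraph.root (fadj F) => FG.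
have gf v : g (f v) = g v.
  have rG a b : uv a b \in F -> g a = g b.
    by move/FG; rewrite labels_root => /eqP.
  apply/esym/(connect_const rG); exact: connect_root.
rewrite (card_labels (labels_root F)) (card_labels (labels_root G)).
apply: leq_trans (leq_imset_card g _); apply/subset_leq_card/subsetP.
by move=> _ /imsetP[v _ ->]; rewrite -/g -gf imset_f // imset_f.
Qed.

Lemma crossing_edge F G lab :
  labels F lab -> #|components G| < #|components F| ->
  exists u v, uv u v \in G /\ lab u != lab v.
Proof.
move=> labF ltGF.
have /existsP[u /existsP[v /andP[Guv luv]]] :
  [exists u, exists v, (uv u v \in G) && (lab u != lab v)]; last by exists u, v.
apply: contraLR ltGF => /existsPn noc; rewrite -leqNgt.
apply: leq_components => u v Guv; rewrite labF.
by have /existsPn/(_ v) := noc u; rewrite Guv negbK.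
Qed.

Lemma labels_merge F lab x y :
  labels F lab ->
  labels (uv x y |: F) (fun u => if lab u == lab y then lab x else lab u).
Proof.
move=> labF; set F' := _ |: F; set lab' := fun u => _.
have sub u v : connect (fadj F) u v -> connect (fadj F') u v.
  by apply: connect_sub => a b Fab; apply: connect1; rewrite fadjE in_setU1 -fadjE Fab orbT.
(* Every u is joined to a vertex whose old label is the new label of u: to x if u lay in the class
   of y, otherwise to itself. *)
have lab'P u : connect (fadj F') u (if lab u == lab y then x else u).
  case: eqP => [/eqP|_]; last exact: connect0.
  rewrite -labF => /sub uy; apply: connect_trans uy _.
  by apply: connect1; rewrite fadjE in_setU1 uvC eqxx.
have lab'E u : lab' u = lab (if lab u == lab y then x else u).
  by rewrite /lab'; case: ifP.
move=> u v; apply/idP/eqP => [|E].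
  apply: connect_const => {u v} u v; rewrite in_setU1 => /orP[|Fuv].
    rewrite uv_eq /lab' => /orP[] /andP[/eqP-> /eqP->]; rewrite eqxx //.
      by case: eqP.
    by case: eqP => // ->.
  by rewrite /lab'; have /eqP-> : lab u == lab v by rewrite -labF connect1.
apply: connect_trans (lab'P u) _; rewrite fconn_sym.
apply: connect_trans (lab'P v) _; apply: sub.
by rewrite labF -!lab'E E.
Qed.

Lemma card_merge F lab x y :
  labels F lab -> lab x != lab y ->
  #|components F| = #|components (uv x y |: F)|.+1.
Proof.
move=> labF xy.
rewrite (card_labels labF) (card_labels (labels_merge _ _ labF)).
rewrite (cardsD1 (lab y)) imset_f //; congr _.+1; congr #|pred_of_set _|.
apply/setP=> z; rewrite !inE; apply/andP/imsetP => [[zy /imsetP[u _ zu]]|[u _ ->]].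
  by exists u; rewrite // -zu (negPf zy).
by case: (eqVneq (lab u) (lab y)) => [_|uy]; split=> //; apply: imset_f.
Qed.

Lemma components_add_leq F x y :
  #|components F| <= #|components (uv x y |: F)|.+1.
Proof.
have labF := labels_root F.
case: (eqVneq (fingraph.root (fadj F) x) (fingraph.root (fadj F) y)).
  move/eqP; rewrite -labF => xy; apply/leqW/leq_components => u v.
  rewrite in_setU1 uv_eq => /orP[/orP[]/andP[/eqP-> /eqP->]|Fuv] //;
    last exact: connect1.
  by rewrite fconn_sym.
by move/(card_merge labF)->.
Qed.

Lemma components_del_leq F e :
  #|components (F :\ e)| <= #|components F|.+1.
Proof.
case: (boolP (e \in F)) => [eF|eF]; last first.
  by have /setDidPl-> : [disjoint F & [set e]]; rewrite ?disjoints1 // disjoint_sym disjoints1.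
have [x [y exy]] := edgeP e; rewrite -{2}(setD1K eF) exy; exact: components_add_leq.
Qed.

Lemma labels0 : labels set0 id.
Proof.
move=> u v; apply/idP/eqP => [|->]; last exact: connect0.
by apply: (@connect_const _ _ id) => a b; rewrite inE.
Qed.

Lemma card_components0 : #|components (set0 : {set edge V})| = #|V|.
Proof. by rewrite (card_labels labels0) imset_id cardsT. Qed.

(** Deleting an edge creates at most one component, and the empty set has |V| of them. Equality
    later serves as the certificate of acyclicity. *)
Lemma leq_card_components F : #|V| <= #|F| + #|components F|.
Proof.
have [k] := ubnP #|F|; elim: k F => // k IHk F; rewrite ltnS => leFk.
case: (set_0Vmem F) => [->|[e eF]]; first by rewrite card_components0 leq_addl.
rewrite (cardsD1 e) eF in leFk *.
apply: leq_trans (IHk (F :\ e) leFk) _.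
by rewrite addSn -addnS leq_add2l components_del_leq.
Qed.

(** Since y is never met and x only at the end, the edge xy is never traversed. *)
Lemma path_avoid F x y t z :
  x \notin z :: t -> y \notin z :: t -> path (fadj F) z (rcons t x) ->
  path (fadj (F :\ uv x y)) z (rcons t x).
Proof.
elim: t z => [|a t IHt] z /=; rewrite !inE ?negb_or.
  move=> xz yz; rewrite !andbT !fadjE in_setD1 uv_eq => ->.
  by rewrite (eq_sym z x) (eq_sym z y) (negPf xz) (negPf yz).
move=> /and3P[xz xa xt] /and3P[yz ya yt] /andP[Fza za].
rewrite fadjE in_setD1 uv_eq -fadjE Fza (eq_sym z x) (eq_sym z y) (negPf xz) (negPf yz) /=.
by apply: IHt; rewrite // inE negb_or ?xa ?ya.
Qed.

(** The rest of the cycle joins the ends of the deleted edge; a loop, the cycle of length one, joins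
    nothing new to begin with. *)
Lemma cycle_del F s :
  uniq s -> cycle (fadj F) s -> size s \notin [:: 0; 2] ->
  exists2 e, e \in F & #|components (F :\ e)| <= #|components F|.
Proof.
case: s => [|x [|y [|z s]]] //.
  rewrite /= andbT => _ Fx _; exists (uv x x) => //; apply: leq_components => u v.
  case: (eqVneq (uv u v) (uv x x)) => [/eqP|ne Fuv].
    by rewrite uv_eq orbb => /andP[/eqP-> /eqP->].
  by rewrite connect1 // fadjE in_setD1 ne.
move=> Us Cs _; have Fxy : uv x y \in F by case/andP: Cs.
exists (uv x y) => //; apply: leq_components => u v.
have yx : connect (fadj (F :\ uv x y)) y x.
  case/andP: Cs => _ Cs; apply/connectP; exists (rcons (z :: s) x); last first.
    by rewrite last_rcons.
  case/andP: Cs => Fyz Cs; move: Us; rewrite !cons_uniq => /and3P[xs ys _].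
  have {ys}ys: y \notin z :: s by [].
  have {xs}[xy xs]: x != y /\ x \notin z :: s.
    by move: xs; rewrite in_cons negb_or => /andP[].
  rewrite /= fadjE in_setD1 -fadjE Fyz andbT uv_eq; apply/andP; split; last exact: path_avoid.
  move: xs ys; rewrite !inE ?negb_or => /andP[xz _] /andP[yz _].
  by rewrite (eq_sym z x) (eq_sym z y) (negPf xz) (negPf yz) !andbF.
case: (eqVneq (uv u v) (uv x y)) => [/eqP|ne Fuv].
  rewrite uv_eq => /orP[] /andP[/eqP-> /eqP->] //; by rewrite fconn_sym.
by rewrite connect1 // fadjE in_setD1 ne.
Qed.

(** With equality in [leq_card_components] every deletion of an edge raises the number of
    components, whereas a cycle would contain an edge whose deletion does not. *)
Lemma forest_card F : #|F| + #|components F| = #|V| -> forest F.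
Proof.
move=> cF s Us Cs; apply/negPn/negP => /(cycle_del Us Cs)[e eF le].
have := leq_card_components (F :\ e); rewrite -cF (cardsD1 e F) eF addSn.
by rewrite leqNgt ltnS leq_add2l le.
Qed.

(** Edges are deleted while the number of components stays at most k. Once no deletion is possible
    the number equals k, and a cycle would still offer an edge to delete. *)
Lemma spanning_subforest S k :
  #|components S| <= k <= #|V| ->
  exists F : {set edge V}, [/\ F \subset S, forest F & #|components F| = k].
Proof.
have [j] := ubnP #|S|; elim: j S => // j IHj S; rewrite ltnS => leSj /andP[Sk kV].
have step e : e \in S -> #|components (S :\ e)| <= k ->
  exists F : {set edge V}, [/\ F \subset S, forest F & #|components F| = k].
  move=> eS leS; have [||F [FS ? ?]] := IHj (S :\ e).
  - by move: leSj; rewrite (cardsD1 e) eS.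
  - by rewrite leS.
  - by exists F; split=> //; apply: subset_trans FS (subsetDl _ _).
have [|Sk'] := ltnP #|components S| k.
  case: (set_0Vmem S) => [->|[e eS]] Sk'.
    by move: Sk'; rewrite card_components0 ltnNge kV.
  by apply: (step e eS); apply: leq_trans (components_del_leq _ _) Sk'.
have Ek : #|components S| = k by apply/eqP; rewrite eqn_leq Sk.
case: (eqVneq (#|S| + #|components S|) #|V|) => [/forest_card fS|ne].
  by exists S; split.
case: (boolP [exists e in S, #|components (S :\ e)| <= k]).
  by case/existsP=> e /andP[]; apply: step.
move/existsPn=> noe; exists S; split=> // s Us Cs.
apply/negPn/negP => /(cycle_del Us Cs)[e eS le].
by have := noe e; rewrite eS -Ek le.
Qed.

End Edges.

(** * Optimality of greedily built forests *)

Section Greedy.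

Local Open Scope ring_scope.

Variables (R : realFieldType) (V : finType) (I : instance R V).

Local Notation fcost := (forest_cost I).

(** Competitors are arbitrary edge sets with at most k components, so the induction may delete any
    edge of G; the edge count makes F a forest by [forest_card]. *)
Definition greedy_opt k (F : {set edge V}) :=
  [/\ #|components F| = k, (#|F| + k)%N = #|V|
    & forall G : {set edge V}, (#|components G| <= k)%N -> fcost F <= fcost G].

Lemma greedy_opt0 : greedy_opt #|V| set0.
Proof.
split=> [||G _]; first exact: card_components0; first by rewrite cards0.
by rewrite /forest_cost big_set0 sumr_ge0 // => e _; apply: cost_of_ge0.
Qed.

Lemma forest_costD1 (F : {set edge V}) e :
  e \in F -> fcost F = cost_of I e + fcost (F :\ e).
Proof. exact: big_setD1. Qed.

(* Any G with at most k components has an edge between two components of F,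
   so the greedy edge is no more expensive than the most expensive edge f of G,
   and G - f has at most k + 1 components. *)
Lemma greedy_opt_step k F lab x y :
  greedy_opt k.+1 F -> labels F lab -> lab x != lab y ->
  (forall u v, lab u != lab v -> cost_of I (uv x y) <= cost_of I (uv u v)) ->
  greedy_opt k (uv x y |: F).
Proof.
case=> cF sF optF labF xy min.
have xyF : uv x y \notin F.
  apply: contra xy => Fxy; by rewrite -labF connect1.
split.
- by have := card_merge labF xy; rewrite cF => -[].
- by rewrite cardsU1 xyF -sF addnS add1n.
move=> G Gk; have [|u [v [Guv luv]]] := crossing_edge labF (G := G).
  by rewrite cF.
case: (arg_maxP (cost_of I) Guv) => f Gf fmax.
rewrite (forest_costD1 (setU11 _ _)) (forest_costD1 Gf) setU1K //.
apply: lerD; first by apply: le_trans (min _ _ luv) (fmax _ Guv).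
by apply: optF; apply: leq_trans (components_del_leq _ _) _.
Qed.

Lemma greedy_opt_min F : greedy_opt (agents I) F -> min_spanning_forest I F.
Proof.
case=> cF sF optF; split=> [|F' [_ cF']]; last by apply: optF; rewrite cF'.
by split=> //; apply: forest_card; rewrite cF.
Qed.

End Greedy.

(** * Degrees, closed walks and shortcuts *)

Section Degrees.

Variable V : finType.
Implicit Types (u v x y : V) (e : edge V) (X : multigraph V).

(** The share of one copy of [e] in the degree of [v], set to zero off [e]: degrees become sums over
    all edges, linear in the multigraph and open to exchange of summation. *)
Definition incidence e v : nat :=
  if v \in val e then if e == loop v then 2 else 1 else 0.

Lemma incidence_uv x y v : incidence (uv x y) v = (x == v) + (y == v).
Proof.
rewrite /incidence in_uv eq_loop (eq_sym v x) (eq_sym v y).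
by case: eqP; case: eqP.
Qed.

Lemma degreeE X v : degree X v = \sum_e incidence e v * X e.
Proof.
rewrite /degree big_mkcond; apply: eq_bigr => e _; rewrite /incidence.
by case: ifP.
Qed.

Lemma degree_munion m (Xs : 'I_m -> multigraph V) v :
  degree (munion Xs) v = \sum_i degree (Xs i) v.
Proof.
under [RHS]eq_bigr do rewrite degreeE.
rewrite exchange_big degreeE; apply: eq_bigr => e _.
by rewrite ffunE big_distrr.
Qed.

Lemma sum_mul_count (f : edge V -> nat) (s : seq (edge V)) :
  \sum_e f e * count_mem e s = \sum_(e <- s) f e.
Proof.
elim: s => [|a s IHs]; first by rewrite big_nil big1 // => e _; rewrite muln0.
rewrite big_cons -IHs (bigD1 a) //= (bigD1 a (F := fun e => f e * count_mem e s)) //=.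
rewrite eqxx mulnDr muln1 addnA; congr (_ + _); apply: eq_bigr => e.
by rewrite eq_sym => /negPf->.
Qed.

(** Unlike [walk_edges] this splits over concatenation; a closed walk is a path with its first
    vertex repeated at the end. *)
Fixpoint path_edges x (s : seq V) : seq (edge V) :=
  if s is y :: s' then uv x y :: path_edges y s' else [::].

Lemma path_edges_cat x s1 s2 :
  path_edges x (s1 ++ s2) = path_edges x s1 ++ path_edges (last x s1) s2.
Proof. by elim: s1 x => //= y s1 IHs x; rewrite IHs. Qed.

Lemma walk_edges_cons x s : walk_edges (x :: s) = path_edges x (rcons s x).
Proof.
rewrite /walk_edges rot1_cons; move: {2 4}x => z.
by elim: s x => //= y s IHs x; rewrite IHs.
Qed.

Lemma sum_path_incidence x s v :
  \sum_(e <- path_edges x s) incidence e v =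
  count_mem v (belast x s) + count_mem v s.
Proof.
elim: s x => [|y s IHs] x /=; first by rewrite big_nil.
by rewrite big_cons IHs incidence_uv addnACA.
Qed.

Lemma degree_walk (w : seq V) v : degree (walk_graph w) v = 2 * count_mem v w.
Proof.
rewrite degreeE; under eq_bigr do rewrite ffunE.
rewrite sum_mul_count; case: w => [|x s]; first by rewrite big_nil.
rewrite walk_edges_cons sum_path_incidence belast_rcons mul2n -addnn.
by congr (_ + _); rewrite -cats1 count_cat /= addn0 addnC.
Qed.

Lemma degree_loop v0 v :
  degree [ffun e => nat_of_bool (e == loop v0)] v = 2 * (v == v0).
Proof.
rewrite degreeE (bigD1 (loop v0)) //= ffunE eqxx muln1 big1; last first.
  by move=> e /negPf ne; rewrite ffunE ne muln0.
by rewrite addn0 incidence_uv addnn mul2n eq_sym.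
Qed.

Lemma sum_loops (f : edge V -> nat) (P : pred V) (k : V -> nat) :
  \sum_e f e * (\sum_(v | P v) if e == loop v then k v else 0) =
  \sum_(v | P v) f (loop v) * k v.
Proof.
under eq_bigr do rewrite big_distrr /=.
rewrite exchange_big /=; apply: eq_bigr => v _.
rewrite (bigD1 (loop v)) //= eqxx big1 ?addn0 // => e /negPf->.
by rewrite muln0.
Qed.

Lemma degree_add_loops X (P : pred V) (k : V -> nat) v :
  degree [ffun e => X e + \sum_(u | P u) if e == loop u then k u else 0] v =
  degree X v + (if P v then 2 * k v else 0).
Proof.
rewrite !degreeE; under eq_bigr do rewrite ffunE mulnDr.
rewrite big_split sum_loops /=; congr (_ + _).
rewrite big_mkcond (bigD1 v) //= big1 ?addn0; last first.
  by move=> u /negPf ne; rewrite incidence_uv ne; case: ifP.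
by rewrite incidence_uv eqxx.
Qed.

Lemma degree_loops (P : pred V) (k : V -> nat) v :
  degree [ffun e => \sum_(u | P u) if e == loop u then k u else 0] v =
  if P v then 2 * k v else 0.
Proof.
have := degree_add_loops [ffun e => 0] P k v.
rewrite [X in X + _]degreeE [X in X + _]big1 ?add0n => [<-|e _]; last first.
  by rewrite ffunE muln0.
by congr (degree _ v); apply/ffunP=> e; rewrite !ffunE.
Qed.

Lemma adjE X u v : adj X u v = (0 < X (uv u v)).
Proof. by []. Qed.

Lemma adj_sym X : symmetric (adj X).
Proof. by move=> u v; rewrite !adjE uvC. Qed.

Lemma path_adj X x s :
  (forall e, e \in path_edges x s -> 0 < X e) -> path (adj X) x s.
Proof.
elim: s x => //= y s IHs x Xe; rewrite adjE Xe ?mem_head // IHs // => e es.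
by apply: Xe; rewrite inE es orbT.
Qed.

Lemma walk_connected (w : seq V) :
  {in w &, forall u v, connect (adj (walk_graph w)) u v}.
Proof.
case: w => // x s.
have Pw : path (adj (walk_graph (x :: s))) x (rcons s x).
  by apply: path_adj => e; rewrite ffunE walk_edges_cons -has_pred1 has_count.
have cx v : v \in x :: s -> connect (adj (walk_graph (x :: s))) x v.
  move=> vs; apply: (path_connect Pw).
  by rewrite inE mem_rcons vs orbT.
move=> u v /cx xu /cx; apply: connect_trans.
by rewrite (sym_connect_sym (@adj_sym _)).
Qed.

Lemma mem_walk_edge (w : seq V) v e :
  e \in walk_edges w -> v \in val e -> v \in w.
Proof.
case: w => // x s; rewrite walk_edges_cons.
have: {subset x :: rcons s x <= x :: s}.
  by move=> z; rewrite inE mem_rcons => /orP[/eqP->|//]; rewrite mem_head.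
move: (x :: s) (rcons s x) => w t; elim: t x => //= y t IHt x sub.
rewrite inE => /orP[/eqP->|et].
  by rewrite in_uv => /orP[] /eqP->; rewrite sub ?inE ?eqxx ?orbT.
by apply: IHt et => z zt; rewrite sub // inE zt orbT.
Qed.

Lemma shortcut_rcons s x :
  shortcut (rcons s x) = if x \in s then shortcut s else rcons (shortcut s) x.
Proof. by rewrite /shortcut rev_rcons /= mem_rev; case: ifP; rewrite ?rev_cons. Qed.

Lemma mem_shortcut (s : seq V) : shortcut s =i s.
Proof. by move=> x; rewrite mem_rev mem_undup mem_rev. Qed.

Lemma shortcut_uniq (s : seq V) : uniq (shortcut s).
Proof. by rewrite rev_uniq undup_uniq. Qed.

Lemma shortcut_cat (s t : seq V) :
  shortcut (s ++ t) = shortcut s ++ [seq x <- shortcut t | x \notin s].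
Proof.
elim/last_ind: t => [|t x IHt]; first by rewrite !cats0.
rewrite -rcons_cat !shortcut_rcons mem_cat IHt.
case: (boolP (x \in t)) => xt; rewrite ?orbT ?orbF //.
by rewrite filter_rcons; case: (x \in s) => //=; rewrite rcons_cat.
Qed.

Lemma shortcut_cons x s :
  shortcut (x :: s) = x :: [seq y <- shortcut s | y != x].
Proof.
rewrite -cat1s shortcut_cat; congr (_ :: _); apply: eq_filter => y.
by rewrite inE.
Qed.

Lemma shortcut_subseq (s : seq V) : subseq (shortcut s) s.
Proof. by rewrite -[s in subseq _ s]revK subseq_rev undup_subseq. Qed.

End Degrees.

(** * The approximation ratio *)

Section Costs.

Variables (R : realFieldType) (V : finType) (I : instance R V).
Implicit Types (u v x y : V) (e : edge V) (X : multigraph V).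

Local Open Scope ring_scope.

Local Notation c := (cost_of I).
Local Notation m := (agents I).
Local Notation rq := (request I).

Lemma cost_munion (Xs : 'I_m -> multigraph V) :
  cost I (munion Xs) = \sum_i cost I (Xs i).
Proof.
rewrite exchange_big; apply: eq_bigr => e _.
by rewrite ffunE sumrMnr.
Qed.

Lemma sum_mulrn_count (s : seq (edge V)) :
  \sum_e c e *+ count_mem e s = \sum_(e <- s) c e.
Proof.
elim: s => [|a s IHs]; first by rewrite big_nil big1.
rewrite big_cons -IHs (bigD1 a) //= (bigD1 a (F := fun e => c e *+ count_mem e s)) //=.
rewrite eqxx mulrnDr addrA; congr (_ + _); apply: eq_bigr => e.
by rewrite eq_sym => /negPf->.
Qed.

Lemma cost_walk (w : seq V) :
  cost I (walk_graph w) = \sum_(e <- walk_edges w) c e.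
Proof. by rewrite -sum_mulrn_count; apply: eq_bigr => e _; rewrite ffunE. Qed.

Lemma cost_doubled (T : {set edge V}) :
  cost I (doubled T) = 2 * \sum_(e in T) c e.
Proof.
rewrite big_distrr [RHS]big_mkcond; apply: eq_bigr => e _; rewrite ffunE.
by case: (e \in T); rewrite ?muln0 // muln1; apply/esym/mulr_natl.
Qed.

Lemma cost_loop v : cost I [ffun e => nat_of_bool (e == loop v)] = c (loop v).
Proof.
rewrite /cost (bigD1 (loop v)) //= ffunE eqxx big1 ?addr0 // => e /negPf ne.
by rewrite ffunE ne.
Qed.

Lemma cost_add_loops X (P : pred V) (k : V -> nat) :
  cost I [ffun e => X e + \sum_(u | P u) if e == loop u then k u else 0]%N =
  cost I X + \sum_(v | P v) c (loop v) *+ k v.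
Proof.
rewrite /cost; under eq_bigr do rewrite ffunE mulrnDr -sumrMnr.
rewrite big_split exchange_big /=; congr (_ + _); apply: eq_bigr => v _.
by rewrite (bigD1 (loop v)) //= eqxx big1 ?addr0 // => e /negPf->.
Qed.

(** Skipping z replaces two consecutive edges by one, which the triangle inequality allows. The
    fixed ends x and y permit closing the walk. *)
Lemma path_cost_subseq (s t : seq V) x y :
  subseq s t ->
  \sum_(e <- path_edges x (rcons s y)) c e <=
  \sum_(e <- path_edges x (rcons t y)) c e.
Proof.
elim: t s x => [|z t IHt] s x; first by move=> /eqP->.
have step s' : \sum_(e <- path_edges x (rcons s' y)) c e <=
    c (uv x z) + \sum_(e <- path_edges z (rcons s' y)) c e.
  case: s' => [|h s'] /=; rewrite !big_cons addrA lerD2r;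
    exact: cost_of_metric.
case: s => [_|h s].
  by rewrite [leRHS]big_cons; apply: le_trans (step _) _; rewrite lerD2l IHt ?sub0seq.
rewrite /=; case: eqP => [<- st|_ st].
  by rewrite !big_cons lerD2l IHt.
apply: le_trans (IHt _ _ st) _; rewrite [leRHS]big_cons; exact: step.
Qed.

Lemma cost_shortcut (w : seq V) :
  cost I (walk_graph (shortcut w)) <= cost I (walk_graph w).
Proof.
rewrite !cost_walk; case: w => [|x s] //.
rewrite shortcut_cons !walk_edges_cons; apply: path_cost_subseq.
exact: subseq_trans (filter_subseq _ _) (shortcut_subseq _).
Qed.

Lemma cost_ge0 X : 0 <= cost I X.
Proof. by apply: sumr_ge0 => e _; rewrite mulrn_wge0 ?cost_of_ge0. Qed.

Lemma even_degree_visits X : (forall v, ~~ odd (degree X v)) ->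
  forall v, degree X v = (2 * visits X v)%N.
Proof. by move=> evX v; rewrite mul2n halfK (negPf (evX v)) subn0. Qed.

Lemma feasible_degree X v : feasible I X -> degree X v = (2 * rq v)%N.
Proof.
case=> visX [Xs [EX tX]]; rewrite -visX; apply: even_degree_visits => {}v.
rewrite EX degree_munion; elim/big_ind: _ => // [a b|i _].
  by rewrite oddD; case: odd; case: odd.
by case: (tX i) => -[].
Qed.

(* Each edge uv with u <> v pays 2 c(uv) for the loop at either endpoint. *)
Lemma loops_le_cost X : feasible I X ->
  \sum_v c (loop v) *+ rq v <= 2 * cost I X.
Proof.
move=> fX; rewrite -(ler_pM2l (_ : 0 < 2)) // big_distrr /=.
have -> : \sum_v 2 * (c (loop v) *+ rq v) =
    \sum_e (\sum_v c (loop v) *+ incidence e v) *+ X e.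
  under [RHS]eq_bigr do rewrite -sumrMnl.
  rewrite exchange_big; apply: eq_bigr => v _ /=.
  rewrite mulr_natl -mulrnA mulnC -(feasible_degree _ fX) degreeE.
  by rewrite -sumrMnr; apply: eq_bigr => e _; rewrite mulrnA.
rewrite mulrA big_distrr; apply: ler_sum => e _ /=.
rewrite mulrnAr lerMn2r; apply/orP; right.
have [u [v ->]] := edgeP e.
have -> : \sum_x c (loop x) *+ incidence (uv u v) x = c (loop u) + c (loop v).
  under eq_bigr do rewrite incidence_uv mulrnDr.
  rewrite big_split /= (bigD1 u) //= (bigD1 v (P := predT)) //= !eqxx.
  rewrite !big1 ?addr0 // => x; rewrite eq_sym => /negPf->; exact: mulr0n.
have [->|uv'] := eqVneq u v.
  have := cost_of_ge0 I (loop v).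
  rewrite -/(loop v) => c0.
  by rewrite -[c _ + _]mulr2n -[leLHS]mulr_natl ler_wpM2r // -natrM ler_nat.
have -> : 2 * 2 * c (uv u v) = 2 * c (uv u v) + 2 * c (uv u v).
  by rewrite -mulrDl -natrM -natrD.
by rewrite lerD ?cost_of_loop // uvC cost_of_loop // eq_sym.
Qed.

(** A tour with an edge has a vertex of positive even degree, hence a visit; visits add up over the
    tours because halving is additive on even degrees. *)
Lemma feasible_agents X : feasible I X -> (m <= total_request I)%N.
Proof.
case=> visX [Xs [EX tX]].
have -> : total_request I = (\sum_i \sum_v visits (Xs i) v)%N.
  rewrite exchange_big; apply: eq_bigr => v _ /=; rewrite -visX.
  apply/eqP; rewrite -(eqn_pmul2l (_ : 0 < 2)%N) // -even_degree_visits; last first.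
    move=> x; rewrite EX degree_munion; elim/big_ind: _ => // [a b|i _].
      by rewrite oddD; case: odd; case: odd.
    by case: (tX i) => -[].
  rewrite EX degree_munion big_distrr; apply/eqP/eq_bigr => i _ /=.
  by apply: even_degree_visits; case: (tX i) => -[].
rewrite -[m in (m <= _)%N]card_ord -sum1_card; apply: leq_sum => i _.
case: (tX i) => -[evX _] [e Xe]; have [x [y exy]] := edgeP e.
rewrite (bigD1 x) //= -(ltn_pmul2l (_ : 0 < 2)%N) // muln0 mulnDr.
rewrite -even_degree_visits // addn_gt0 degreeE (bigD1 e) //= addn_gt0 muln_gt0.
by rewrite exy incidence_uv eqxx -exy Xe.
Qed.

Definition support X : {set edge V} := [set e | 0 < X e]%N.

Lemma cost_support X (F : {set edge V}) :
  F \subset support X -> forest_cost I F <= cost I X.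
Proof.
move=> /subsetP FX; rewrite /forest_cost big_mkcond; apply: ler_sum => e _.
case: ifP => [/FX|_]; last by rewrite mulrn_wge0 ?cost_of_ge0.
rewrite inE; case: (X e) => // k _.
by rewrite mulrS lerDl mulrn_wge0 ?cost_of_ge0.
Qed.

(** Every vertex has positive degree in some tour, and a tour stays within one component, so one
    witness vertex per tour meets all components. *)
Lemma components_support X : feasible I X -> (#|components (support X)| <= m)%N.
Proof.
move=> fX; case: (fX) => visX [Xs [EX tX]].
have lab := labels_root (support X); rewrite (card_labels lab).
set lb := fingraph.root _ in lab *.
have sub i u v : connect (adj (Xs i)) u v -> lb u = lb v.
  move=> cuv; apply/eqP; rewrite -lab; apply: connect_sub cuv => {}u {}v; rewrite adjE => uv0.
  by apply: connect1; rewrite fadjE inE EX ffunE (bigD1 i) //= addn_gt0 uv0.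
have wit i : exists v, v \in vertices (Xs i).
  case: (tX i) => _ [e Xe]; have [x [y exy]] := edgeP e; exists x.
  rewrite inE degreeE (bigD1 e) //= addn_gt0 muln_gt0.
  by rewrite exy incidence_uv eqxx -exy Xe.
pose f i := lb (xchoose (wit i)).
rewrite -[m in (_ <= m)%N]card_ord -cardsT.
apply: leq_trans (leq_imset_card f _); apply/subset_leq_card/subsetP.
move=> _ /imsetP[v _ ->]; have : (0 < degree X v)%N.
  by rewrite feasible_degree // muln_gt0 request_ge1.
rewrite EX degree_munion lt0n sum_nat_eq0 negb_forall => /existsP[i].
rewrite implyTb -lt0n => di; apply/imsetP; exists i => //.
apply: (sub i); case: (tX i) => -[_ ->] //; first by rewrite inE.
exact: (xchooseP (wit i)).
Qed.

Lemma forest_le_cost F X :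
  (m <= #|V|)%N -> min_spanning_forest I F -> feasible I X ->
  forest_cost I F <= cost I X.
Proof.
move=> mV [_ minF] fX.
have [|F' [F'X fF' cF']] := @spanning_subforest V (support X) m.
  by rewrite components_support.
by apply: le_trans (cost_support F'X); apply: minF.
Qed.

(** Leaves only finitely many candidates for feasibility, as the existence of an optimum requires;
    the 2 is that of the degree 2 r(x). *)
Lemma feasible_bound X e : feasible I X -> (X e <= 2 * total_request I)%N.
Proof.
move=> fX; have [x [y exy]] := edgeP e.
apply: leq_trans (_ : degree X x <= _)%N.
  rewrite degreeE (bigD1 e) //= exy incidence_uv eqxx mulnDl mul1n -addnA.
  exact: leq_addr.
by rewrite feasible_degree // leq_mul2l /total_request (bigD1 x) //= leq_addr.
Qed.

(** Feasibility is a proposition without a decision procedure, hence classical case distinctions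
    along a list. *)
Lemma exists_argmin (T : eqType) (P : T -> Prop) (f : T -> R) (s : seq T) :
  (exists2 x, x \in s & P x) ->
  exists2 x, P x & forall y : T, y \in s -> P y -> f x <= f y.
Proof.
elim: s => [|a s IHs]; first by case.
have [[b bs Pb] _|no] := classic (exists2 x, x \in s & P x).
  have [x Px minx] := IHs (ex_intro2 _ _ b bs Pb).
  have [Pa|nPa] := classic (P a); last first.
    by exists x => // y; rewrite inE => /orP[/eqP->|/minx].
  have [le|lt] := leP (f x) (f a).
    by exists x => // y; rewrite inE => /orP[/eqP->|/minx].
  exists a => // y; rewrite inE => /orP[/eqP-> _ //|/minx mx /mx].
  by apply: le_trans; apply: ltW.
case=> x; rewrite inE => /orP[/eqP-> Pa|xs Px]; last by case: no; exists x.
exists a => // y; rewrite inE => /orP[/eqP->|ys Py] //.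
by case: no; exists y.
Qed.

Lemma exists_OPT : (exists X, feasible I X) -> exists o, is_OPT I o.
Proof.
case=> X0 fX0; pose N := (2 * total_request I).+1.
pose g (Y : {ffun edge V -> 'I_N}) : multigraph V := [ffun e => nat_of_ord (Y e)].
have gK X : feasible I X -> exists Y, g Y = X.
  move=> fX; exists [ffun e => inord (X e)]; apply/ffunP=> e.
  by rewrite !ffunE inordK // ltnS feasible_bound.
have [Y0 EY0] := gK _ fX0.
have [|Y fY minY] := @exists_argmin _ (fun Y => feasible I (g Y))
    (fun Y => cost I (g Y)) (enum {ffun edge V -> 'I_N}).
  by exists Y0; rewrite ?mem_enum // EY0.
exists (cost I (g Y)); split; first by exists (g Y).
by move=> X fX; have [Z EZ] := gK _ fX; rewrite -EZ minY ?mem_enum // EZ.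
Qed.

Lemma approximates_none :
  (total_request I < m)%N -> approximates (I := I) 4 None.
Proof.
by move=> lt; split=> // -[X /feasible_agents]; rewrite leqNgt lt.
Qed.

Lemma approximates_some (Xs : 'I_m -> multigraph V) :
  feasible I (munion Xs) ->
  (forall X, feasible I X -> cost I (munion Xs) <= 4 * cost I X) ->
  approximates 4 (Some Xs).
Proof.
move=> fXs le; split=> [no|ex]; first by case: no; exists (munion Xs).
exists Xs; split=> //; have [o oP] := exists_OPT ex; exists o; split=> //.
by case: oP => -[X [fX <-]] _; apply: le.
Qed.

(** The self-loops alone cost at most twice any feasible solution, so this branch even has ratio
    2. *)
Lemma approximates_loops (Xs : 'I_m -> multigraph V) :
  split_loops Xs -> approximates 4 (Some Xs).
Proof.
case=> EXs lXs; apply: approximates_some.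
  split=> [v|]; first by rewrite /visits EXs (degree_loops predT) mul2n doubleK.
  exists Xs; split=> // i; have [ne [v Xv]] := lXs i; split=> //.
  have dX x : degree (Xs i) x = (2 * ((x == v) * Xs i (loop v)))%N.
    rewrite degreeE (bigD1 (loop v)) //= big1 ?addn0.
      by rewrite incidence_uv addnn -mul2n -mulnA eq_sym.
    move=> e ne'; case: (posnP (Xs i e)) => [->|/Xv E]; first by rewrite muln0.
    by rewrite E eqxx in ne'.
  split=> [x|x y]; first by rewrite dX mul2n odd_double.
  rewrite !inE !dX; case: eqP => // ->; case: eqP => // -> _ _; exact: connect0.
move=> X fX; rewrite EXs.
have -> : cost I [ffun e => \sum_v if e == loop v then rq v else 0]%N =
    \sum_v c (loop v) *+ rq v.
  rewrite /cost; under eq_bigr do rewrite ffunE -sumrMnr.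
  rewrite exchange_big /=; apply: eq_bigr => v _.
  by rewrite (bigD1 (loop v)) //= eqxx big1 ?addr0 // => e /negPf->.
apply: le_trans (loops_le_cost fX) _; rewrite ler_wpM2r ?cost_ge0 //.
by rewrite ler_nat.
Qed.

Section ForestOutcome.

Variables (F : {set edge V}) (W : 'I_m -> {set V}) (H : 'I_m -> multigraph V).
Variable pick : V -> 'I_m.
Hypotheses (Winj : injective W) (WF : W @: [set: 'I_m] = components F).
Hypothesis HW : forall i, cycle_of (edges_in F (W i)) (W i) (H i).
Hypothesis pickH : forall v, v \in vertices (H (pick v)).

Lemma component_conn i v u : v \in W i -> (u \in W i) = connect (fadj F) v u.
Proof.
have /imsetP[x _ ->] : W i \in components F by rewrite -WF imset_f.
rewrite !inE => xv; apply/idP/idP; last exact: connect_trans.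
by apply: connect_trans; rewrite fconn_sym.
Qed.

Lemma component_uniq i j v : v \in W i -> v \in W j -> i = j.
Proof.
move=> vi vj; apply: Winj; apply/setP=> u.
by rewrite (component_conn _ vi) (component_conn _ vj).
Qed.

(** Visited vertices lie on doubled edges inside the component. Conversely, a second vertex in the
    component forces a forest edge at v; this is where two vertices are needed. *)
Lemma walk_component i w :
  (2 <= #|W i|)%N -> walk_graph w = doubled (edges_in F (W i)) -> w =i W i.
Proof.
move=> W2 Ew v.
have Ee e : (e \in walk_edges w) = (e \in edges_in F (W i)).
  have /ffunP/(_ e) := Ew; rewrite !ffunE -has_pred1 has_count => ->.
  by case: (e \in _).
apply/idP/idP => vw.
  have : (0 < degree (walk_graph w) v)%N.
    by rewrite degree_walk muln_gt0 -has_count has_pred1.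
  rewrite Ew degreeE lt0n sum_nat_eq0 negb_forall => /existsP[e].
  rewrite implyTb -lt0n muln_gt0 ffunE muln_gt0 lt0b => /and3P[iv _].
  rewrite inE => /andP[_ /subsetP]; apply.
  by move: iv; rewrite /incidence; case: ifP.
have [u] : exists u, u \in W i :\ v.
  by apply/card_gt0P; move: W2; rewrite (cardsD1 v) vw.
rewrite !inE => /andP[uv'].
rewrite (component_conn _ vw) => /connectP[[|y p] /=].
  by move=> _ E; rewrite E eqxx in uv'.
case/andP=> vy _ _; apply: (@mem_walk_edge _ _ _ (uv v y)).
  rewrite Ee inE -fadjE vy; apply/subsetP=> x; rewrite in_uv => /orP[] /eqP-> //.
  by rewrite (component_conn _ vw) connect1.
by rewrite in_uv eqxx.
Qed.

Lemma degree_cycle i v : degree (H i) v = (2 * (v \in W i))%N.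
Proof.
have := HW i; rewrite /cycle_of; case: ifP => [W2 [w [Ew ->]]|_ [x [-> ->]]].
  rewrite degree_walk count_uniq_mem ?shortcut_uniq //.
  by rewrite mem_shortcut (walk_component W2 Ew).
by rewrite degree_loop inE.
Qed.

Lemma cycle_connected i : {in W i &, forall u v, connect (adj (H i)) u v}.
Proof.
have := HW i; rewrite /cycle_of; case: ifP => [W2 [w [Ew ->]]|_ [x [-> ->]]] u v.
  rewrite -!(walk_component W2 Ew) -!(mem_shortcut w); exact: walk_connected.
by rewrite !inE => /eqP-> /eqP->; apply: connect0.
Qed.

Lemma pick_component v : v \in W (pick v).
Proof. by have := pickH v; rewrite inE degree_cycle; case: (v \in _). Qed.

Lemma feasible_outcome : feasible I (munion (add_loops H pick)).
Proof.
split=> [v|].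
  rewrite /visits degree_munion.
  under eq_bigr do rewrite degree_add_loops degree_cycle.
  rewrite big_split /= -[X in (_ + X)%N]big_mkcond /=.
  rewrite (bigD1 (pick v)) //= pick_component big1 ?addn0; last first.
    move=> j ne; case: (boolP (v \in W j)) => // vj.
    by rewrite (component_uniq vj (pick_component v)) eqxx in ne.
  rewrite (big_pred1 (pick v)) => [|j]; last by rewrite eq_sym.
  by rewrite -mulnDr mul2n doubleK addnC subnK ?request_ge1.
exists (add_loops H pick); split=> // i.
have vW v : v \in vertices (add_loops H pick i) -> v \in W i.
  rewrite inE degree_add_loops degree_cycle.
  by case: eqP => [<-|_]; [rewrite pick_component | case: (v \in _)].
have adjS u v : connect (adj (H i)) u v -> connect (adj (add_loops H pick i)) u v.
  apply: connect_sub => {}u {}v; rewrite adjE => uv0; apply: connect1.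
  by rewrite adjE ffunE addn_gt0 uv0.
split; first split=> [v|u v /vW ui /vW vi].
- rewrite degree_add_loops degree_cycle.
  by case: ifP => _; rewrite -?mulnDr mul2n ?addn0 odd_double.
- exact/adjS/cycle_connected.
have /imsetP[x _ Wx] : W i \in components F by rewrite -WF imset_f.
have : (0 < degree (H i) x)%N by rewrite degree_cycle Wx inE connect0.
rewrite degreeE lt0n sum_nat_eq0 negb_forall => /existsP[e].
rewrite implyTb -lt0n muln_gt0 => /andP[_ He]; exists e.
by rewrite ffunE addn_gt0 He.
Qed.

(** The second sum pays for the loop of a singleton component and is slack otherwise. Together with
    the r(v) - 1 added loops it makes up r(v) loops at each v, which are charged anyway. *)
Lemma cost_cycle i :
  cost I (H i) <= 2 * \sum_(e in edges_in F (W i)) c e + \sum_(v in W i) c (loop v).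
Proof.
have ge0 (A : {set edge V}) : 0 <= \sum_(e in A) c e.
  by apply: sumr_ge0 => e _; apply: cost_of_ge0.
have := HW i; rewrite /cycle_of; case: ifP => [W2 [w [Ew ->]]|_ [x [-> ->]]].
  rewrite -cost_doubled -Ew; apply: le_trans (cost_shortcut w) _.
  by rewrite lerDl sumr_ge0 // => v _; apply: cost_of_ge0.
by rewrite cost_loop big_set1 lerDr mulr_ge0.
Qed.

Lemma cost_outcome :
  cost I (munion (add_loops H pick)) <=
  2 * forest_cost I F + \sum_v c (loop v) *+ rq v.
Proof.
have pickE i v : (v \in W i) = (pick v == i).
  apply/idP/eqP => [vi|<-]; last exact: pick_component.
  exact: component_uniq (pick_component v) vi.
have part (f : V -> R) : \sum_i \sum_(v | pick v == i) f v = \sum_v f v.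
  by rewrite [RHS](partition_big pick predT).
rewrite cost_munion; under eq_bigr do rewrite cost_add_loops.
rewrite big_split /= part.
have -> : \sum_v c (loop v) *+ rq v =
    \sum_i \sum_(v in W i) c (loop v) + \sum_v c (loop v) *+ (rq v - 1).
  rewrite (eq_bigr (fun i => \sum_(v | pick v == i) c (loop v))); last first.
    by move=> i _; apply: eq_bigl => v; rewrite pickE.
  rewrite part -big_split; apply: eq_bigr => v _ /=.
  by rewrite -mulrS -subSn ?request_ge1 // subn1.
rewrite addrA lerD2r; apply: le_trans (ler_sum _ (fun i _ => cost_cycle i)) _.
rewrite big_split lerD2r -big_distrr /= ler_wpM2l //.
(* Each edge is charged to the component of an arbitrary endpoint; an edge inside [W i] is thus
   charged to i, and none is counted twice. *)
have ne (e : edge V) : exists x, x \in val e.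
  by apply/card_gt0P; case/andP: (valP e).
rewrite /forest_cost (partition_big (fun e => pick (xchoose (ne e))) predT) //=.
apply: ler_sum => i _; rewrite big_mkcond [leRHS]big_mkcond.
apply: ler_sum => e _; rewrite inE.
have [eW|_] := boolP (val e \subset W i); last first.
  by rewrite andbF; case: ifP => // _; apply: cost_of_ge0.
suff -> : pick (xchoose (ne e)) == i by [].
by rewrite -pickE (subsetP eW) // (xchooseP (ne e)).
Qed.

Lemma approximates_forest :
  (m <= #|V|)%N -> min_spanning_forest I F ->
  approximates 4 (Some (add_loops H pick)).
Proof.
move=> mV minF; apply: approximates_some => [|X fX]; first exact: feasible_outcome.
apply: le_trans cost_outcome _.
have -> : 4 * cost I X = 2 * cost I X + 2 * cost I X by rewrite -mulrDl -natrD.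
by rewrite lerD ?loops_le_cost // ler_wpM2l // forest_le_cost.
Qed.

End ForestOutcome.

End Costs.

Theorem algorithm_approximates (R : realFieldType) (V : finType)
    (I : instance R V) (out : outcome I) :
  algorithm out -> approximates 4%R out.
Proof.
case=> [lt|Xs _ _|F W H pick _ mV minF Winj WF HW pickH].
- exact: approximates_none.
- exact: approximates_loops.
- exact: (approximates_forest Winj WF HW pickH mV minF).
Qed.

(** * Programs with bounded loops *)

(* Unqualified, [Num] is the number notation of ssrnat. *)
Local Notation Lit := Defs.Num (only parsing).

(* Programs whose loops run a counter x from 0 to n or m (cell h of array 0). *)
Inductive fprog :=
| FSkip
| FAssign of nat & expr & expr
| FSeq of fprog & fprog
| FIf of expr & fprog & fprog
| FFor (x h : nat) (p : fprog).

Fixpoint compile (p : fprog) : prog :=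
  match p with
  | FSkip => Skip
  | FAssign a i e => Assign a i e
  | FSeq p q => Seq (compile p) (compile q)
  | FIf e p q => If e (compile p) (compile q)
  | FFor x h p =>
      Seq (Assign x (Lit 0) (Lit 0))
        (While (Op Leq (Op Add (Cell x (Lit 0)) (Lit 1)) (Cell 0 (Lit h)))
           (Seq (compile p)
              (Assign x (Lit 0) (Op Add (Cell x (Lit 0)) (Lit 1)))))
  end.

Fixpoint writes (p : fprog) : seq nat :=
  match p with
  | FSkip => [::]
  | FAssign a _ _ => [:: a]
  | FSeq p q | FIf _ p q => writes p ++ writes q
  | FFor x _ p => x :: writes p
  end.

Fixpoint mul_free (e : expr) : bool :=
  match e with
  | Lit _ => true
  | Cell _ i => mul_free i
  | Op o e1 e2 => [&& if o is Mul then false else true, mul_free e1 & mul_free e2]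
  | CostLe e1 e2 e3 e4 =>
      [&& mul_free e1, mul_free e2, mul_free e3 & mul_free e4]
  end.

(* Without multiplications every step adds only a constant to the bit lengths. *)
Fixpoint wf (p : fprog) : bool :=
  match p with
  | FSkip => true
  | FAssign a i e => [&& a != 0, mul_free i & mul_free e]
  | FSeq p q => wf p && wf q
  | FIf e p q => [&& mul_free e, wf p & wf q]
  | FFor x h p => [&& x != 0, x \notin writes p, h < 2 & wf p]
  end.

Lemma blen_leq k b : k < 2 ^ b -> 0 < b -> blen k <= b.
Proof.
move=> kb b0; rewrite /blen; case: (posnP k) => [->|k0]; first by rewrite trunc_log0.
by rewrite -(ltn_exp2l _ _ (ltnSn 1)); apply: leq_ltn_trans (trunc_logP _ k0) kb.
Qed.

Lemma ltn_blen k : k < 2 ^ blen k.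
Proof. exact: trunc_log_ltn. Qed.

Lemma leq_blen k l : k <= l -> blen k <= blen l.
Proof. by move=> kl; apply: blen_leq => //; apply: leq_ltn_trans kl (ltn_blen l). Qed.

Lemma blen_add k l : blen (k + l) <= (maxn (blen k) (blen l)).+1.
Proof.
apply: blen_leq => //; rewrite expnS mul2n -addnn -addSn leq_add //.
  by apply: leq_trans (ltn_blen k) _; rewrite leq_exp2l // leq_maxl.
by apply/ltnW/(leq_trans (ltn_blen l)); rewrite leq_exp2l // leq_maxr.
Qed.

Lemma blen_self k : blen k <= k.+1.
Proof. by apply: blen_leq => //; apply: leq_trans (ltn_expl k.+1 (ltnSn 1)). Qed.

Lemma blen_bool (b : bool) : blen b <= 1.
Proof. by case: b. Qed.

Section Semantics.

Variable cle : nat -> nat -> nat -> nat -> bool.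
Implicit Types (s : memory) (p q : fprog).

Definition tick (x : nat) s : memory := update s x 0 (s x 0 + 1).

(** Total, since loops run a fixed number of times. The bound is read once on entry while the
    compiled loop rereads it; both agree because well-formed programs never write array 0. *)
Fixpoint den p s : memory :=
  match p with
  | FSkip => s
  | FAssign a i e => update s a (eval cle s i) (eval cle s e)
  | FSeq p q => den q (den p s)
  | FIf e p q => if eval cle s e != 0 then den p s else den q s
  | FFor x h p => iter (s 0 h) (fun s => tick x (den p s)) (update s x 0 0)
  end.

Lemma update_neq s a i k b j : b != a -> update s a i k b j = s b j.
Proof. by rewrite /update => /negPf->. Qed.

Lemma den_frame p s a i : a \notin writes p -> den p s a i = s a i.
Proof.
elim: p s => //= [b e1 e2|p IHp q IHq|e p IHp q IHq|x h p IHp] s.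
- by rewrite inE => /update_neq->.
- by rewrite mem_cat => /norP[? ?]; rewrite IHq // IHp.
- by rewrite mem_cat => /norP[? ?]; case: ifP; rewrite ?IHq ?IHp.
rewrite inE negb_or => /andP[ax ap].
elim: (s 0 h) => [|k IHk] /=; first by rewrite update_neq.
by rewrite /tick update_neq // IHp.
Qed.

Lemma wf_writes p : wf p -> 0 \notin writes p.
Proof.
elim: p => //= [a i e|p IHp q IHq|e p IHp q IHq|x h p IHp].
- by rewrite inE eq_sym => /andP[].
- by rewrite mem_cat => /andP[/IHp/negPf-> /IHq/negPf->].
- by rewrite mem_cat => /and3P[_ /IHp/negPf-> /IHq/negPf->].
by rewrite inE eq_sym => /and4P[/negPf-> _ _ /IHp/negPf->].
Qed.

(* The invariant J may rely on the counter and on the arrays that the loop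
   does not write. *)
Lemma den_for x h p s (J : nat -> memory -> Prop) :
  x \notin writes p ->
  J 0 (update s x 0 0) ->
  (forall k s', k < s 0 h -> s' x 0 = k ->
     (forall a i, a \notin x :: writes p -> s' a i = s a i) ->
     J k s' -> J k.+1 (tick x (den p s'))) ->
  J (s 0 h) (den (FFor x h p) s).
Proof.
move=> xp J0 JS /=.
suff H k : k <= s 0 h ->
    let s' := iter k (fun s => tick x (den p s)) (update s x 0 0) in
    [/\ s' x 0 = k, forall a i, a \notin x :: writes p -> s' a i = s a i & J k s'].
  by case: (H _ (leqnn _)).
elim: k => [|k IHk] /= kh.
  split=> // [|a i]; first by rewrite /update !eqxx.
  by rewrite inE negb_or => /andP[/update_neq-> _].
have [xk fr Jk] := IHk (ltnW kh); split=> [|a i ax|]; last exact: JS.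
  by rewrite /tick /update !eqxx /= den_frame // xk addn1.
have := ax; rewrite inE negb_or => /andP[ne nw].
by rewrite /tick update_neq // den_frame // fr.
Qed.

End Semantics.

(** * Polynomial bounds on time and bit lengths *)

Section Time.

Implicit Types (s : memory) (p q : fprog) (B N K d : nat).

Definition bounded s B := forall a i, blen (s a i) <= B.

Lemma bounded_gt0 s B : bounded s B -> 0 < B.
Proof. by move/(_ 0 0); apply: leq_trans. Qed.

Lemma boundedW s B B' : B <= B' -> bounded s B -> bounded s B'.
Proof. by move=> le sB a i; apply: leq_trans (sB a i) le. Qed.

Lemma bounded_update s a i k B :
  bounded s B -> blen k <= B -> bounded (update s a i k) B.
Proof. by move=> sB kB b j; rewrite /update; case: ifP. Qed.

(** One K serves all memories and all comparison oracles. Without multiplication the result exceeds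
    the longest number in memory by at most K bits. *)
Lemma eval_bound e : mul_free e -> exists K, forall cle s B, bounded s B ->
  eval_time cle s e <= K * B /\ blen (eval cle s e) <= K + B.
Proof.
elim: e => /= [k _|a i IHi /IHi{IHi}[K HK]|o e1 IH1 e2 IH2|
    e1 IH1 e2 IH2 e3 IH3 e4 IH4].
- exists (blen k) => cle s B /bounded_gt0 B0.
  by rewrite leq_pmulr // leq_addr.
- exists (K + K + 2) => cle s B sB; have B0 := bounded_gt0 sB.
  have [H1 H2] := HK cle s B sB; have H3 := sB a (eval cle s i).
  split; last lia.
  have : K <= K * B by rewrite leq_pmulr.
  rewrite !mulnDl; lia.
- case/and3P=> oM /IH1[K1 H1] /IH2[K2 H2].
  exists (K1 + K1 + (K2 + K2) + 2) => cle s B sB; have B0 := bounded_gt0 sB.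
  have [] := H1 cle s B sB; have [] := H2 cle s B sB.
  move: (eval cle s e1) (eval cle s e2) => x y t2 l2 t1 l1.
  have k1 : K1 <= K1 * B by rewrite leq_pmulr.
  have k2 : K2 <= K2 * B by rewrite leq_pmulr.
  split; first by case: o oM => //= _; rewrite !mulnDl; lia.
  case: o oM => //= _.
  + by have := blen_add x y; lia.
  + by have := leq_blen (leq_subr y x); lia.
  + by have := blen_bool (x <= y); lia.
case/and4P=> /IH1[K1 H1] /IH2[K2 H2] /IH3[K3 H3] /IH4[K4 H4].
exists (K1 + K1 + (K2 + K2) + (K3 + K3) + (K4 + K4) + 4) => cle s B sB.
have B0 := bounded_gt0 sB.
have [a1 b1] := H1 cle s B sB; have [a2 b2] := H2 cle s B sB.
have [a3 b3] := H3 cle s B sB; have [a4 b4] := H4 cle s B sB.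
have k1 : K1 <= K1 * B by rewrite leq_pmulr.
have k2 : K2 <= K2 * B by rewrite leq_pmulr.
have k3 : K3 <= K3 * B by rewrite leq_pmulr.
have k4 : K4 <= K4 * B by rewrite leq_pmulr.
split; first by rewrite !mulnDl; lia.
by apply: leq_trans (blen_bool _) _; lia.
Qed.

Lemma leq_exp2rW a b e : a <= b -> a ^ e <= b ^ e.
Proof. by move=> ab; elim: e => // e IHe; rewrite !expnS leq_mul. Qed.

Lemma leq_poly K K' d d' n : 0 < n -> K <= K' -> d <= d' -> K * n ^ d <= K' * n ^ d'.
Proof. by move=> n0 KK dd; rewrite leq_mul // leq_pexp2l. Qed.

(** Serves a program started in a memory whose lengths have already grown to B + K N^d: the new sum
    N + B is bounded by a power of the old one. *)
Lemma leq_compose N B K d : 0 < N -> 0 < B ->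
  N + (B + K * N ^ d) <= K.+1 * (N + B) ^ d.+1.
Proof.
move=> N0 B0; rewrite mulSn addnA leq_add //.
  by rewrite -{1}(expn1 (N + B)) leq_pexp2l // addn_gt0 N0.
rewrite leq_mul2l expnS; apply/orP; right.
apply: leq_trans (_ : (N + B) ^ d <= _); first by rewrite leq_exp2rW // leq_addr.
by rewrite leq_pmull // addn_gt0 N0.
Qed.

(** The time may depend on B, but the growth [K * N ^ d] of the lengths may not, so that N rounds of
    a loop add at most N such terms. *)
Definition poly_time p K d := forall cle s N B,
  0 < N -> s 0 0 <= N -> s 0 1 <= N -> bounded s B ->
  [/\ exists2 t, exec cle (compile p) s t (den cle p s) & t <= K * (N + B) ^ d
    & bounded (den cle p s) (B + K * N ^ d)].

(** The second program starts from lengths up to B + Kp N^dp; [leq_compose] turns this into the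
    factor [Kp.+1 ^ dq] and the exponent [dp.+1 * dq]. *)
Lemma poly_time_seq p q Kp dp Kq dq : wf p ->
  poly_time p Kp dp -> poly_time q Kq dq ->
  poly_time (FSeq p q) (Kp + Kq * Kp.+1 ^ dq) (dp + dp.+1 * dq).
Proof.
move=> wfp Hp Hq cle s N B N0 s0 s1 sB; have B0 := bounded_gt0 sB.
have NB0 : 0 < N + B by rewrite addn_gt0 N0.
have [[t1 E1 T1] B1] := Hp cle s N B N0 s0 s1 sB.
have [||[t2 E2 T2] B2] := Hq cle (den cle p s) N _ N0 _ _ B1.
- by rewrite den_frame // wf_writes.
- by rewrite den_frame // wf_writes.
split; last first.
  apply: boundedW B2; rewrite -addnA leq_add2l mulnDl leq_add //.
    by rewrite leq_poly // leq_addr.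
  rewrite leq_mul // ?leq_pmulr ?expn_gt0 // leq_pexp2l //; lia.
exists (t1 + t2); first exact: Exec_seq E1 E2.
rewrite mulnDl leq_add //; first by rewrite (leq_trans T1) // leq_poly // leq_addr.
apply: leq_trans T2 _; rewrite -mulnA leq_mul2l; apply/orP; right.
apply: leq_trans (_ : (Kp.+1 * (N + B) ^ dp.+1) ^ dq <= _).
  by rewrite leq_exp2rW // leq_compose.
by rewrite expnMn -expnM leq_mul2l leq_pexp2l ?orbT ?leq_addl.
Qed.

Lemma poly_time_for x h p K d : wf (FFor x h p) -> poly_time p K d ->
  exists K' d', poly_time (FFor x h p) K' d'.
Proof.
move=> /= /and4P[x0 xp h2 wfp] Hp.
set g := Op Leq (Op Add (Cell x (Lit 0)) (Lit 1)) (Cell 0 (Lit h)).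
have [Kg Hg] : exists Kg, forall cle s B, bounded s B ->
  eval_time cle s g <= Kg * B /\ blen (eval cle s g) <= Kg + B by exact: eval_bound.
have [Ku Hu] := @eval_bound (Op Add (Cell x (Lit 0)) (Lit 1)) isT.
(* The summands pay for guard, body and counter increment of one round; the power of [K.+2] comes
   from [leq_compose] at the greatest length reached in the loop. *)
pose C := (Kg + K + (Ku + Ku + 3)) * K.+2 ^ d.+1.
exists (4 + 2 * C + K.+1), (d.+2 * d.+2) => cle s N B N0 s0 s1 sB.
have B0 := bounded_gt0 sB; have NB0 : 0 < N + B by rewrite addn_gt0 N0.
have Bs i : i <= N -> B + i * (K * N ^ d + 1) <= B + K.+1 * N ^ d.+1.
  move=> iN; rewrite leq_add2l expnS mulnCA leq_mul // addn1 mulSn addnC.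
  by rewrite -addn1 leq_add2l expn_gt0 N0.
pose M := N + (B + K.+1 * N ^ d.+1).
have hN : s 0 h <= N by case: h h2 {g Hg Kg C} => [|[]].
have blenS s' B' : bounded s' B' -> bounded (tick x s') (B' + 1).
  move=> sB'; apply: bounded_update; first by apply: boundedW sB'; rewrite leq_addr.
  apply: leq_trans (blen_add _ _) _; have := sB' x 0; have := bounded_gt0 sB'.
  by rewrite (_ : blen 1 = 1) //; lia.
pose f s' := tick x (den cle p s'); pose G := K * N ^ d + 1.
pose Bm := B + K.+1 * N ^ d.+1.
pose D := (Kg + K + (Ku + Ku + 3)) * M ^ d.+1.
have M0 : 0 < M by rewrite /M addn_gt0 N0.
have MM : M <= M ^ d.+1 by rewrite -{1}(expn1 M) leq_pexp2l.
(* After k rounds, with j to go, lengths have grown by k times G, whose summand 1 is due to the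
   counter; [j.+1] includes the final failing test. *)
have loop j k s' : k + j = s 0 h -> s' x 0 = k -> (forall i, s' 0 i = s 0 i) ->
    bounded s' (B + k * G) ->
  (exists2 t, exec cle (While g (Seq (compile p)
       (Assign x (Lit 0) (Op Add (Cell x (Lit 0)) (Lit 1))))) s' t (iter j f s')
     & t <= j.+1 * D) /\ bounded (iter j f s') (B + s 0 h * G).
  elim: j k s' => [|j IHj] k s' kj xk s'0 sB'.
    rewrite addn0 in kj; split; last by rewrite -kj.
    have [tg _] := Hg cle s' _ sB'; exists (eval_time cle s' g).
      by apply: Exec_while_false; rewrite /= xk s'0 -kj addn1 ltnn.
    rewrite mul1n; apply: leq_trans tg _; rewrite leq_mul //.
      by rewrite -addnA leq_addr.
    apply: leq_trans MM; apply: leq_trans (Bs k _) _; first by rewrite kj.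
    by rewrite /M leq_addl.
  have kN : k.+1 <= N by apply: leq_trans hN; rewrite -kj; lia.
  have [tg _] := Hg cle s' _ sB'.
  have [||[t1 E1 T1] B1] := Hp cle s' N _ N0 _ _ sB'; rewrite ?s'0 //.
  have B1' : bounded (f s') (B + k.+1 * G).
    by apply: boundedW (blenS _ _ B1); rewrite mulSn /G; lia.
  have [] := Hu cle _ _ B1; set eu := eval_time _ _ _ => T2 L2.
  have [|||[t3 E3 T3] B3] := IHj k.+1 (f s') _ _ _ B1'.
  - by rewrite addSnnS.
  - by rewrite /f /tick /update !eqxx /= den_frame // xk addn1.
  - by move=> i; rewrite /f /tick update_neq 1?eq_sym // den_frame ?s'0 ?wf_writes.
  rewrite iterSr; split=> //.
  exists (eval_time cle s' g + (t1 + (1 + eu + blen 0 + blen (den cle p s' x 0 + 1))) + t3).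
    apply: Exec_while_true E3; first by rewrite /= xk s'0 -kj; lia.
    apply: Exec_seq E1 _; exact: Exec_assign.
  rewrite mulSn leq_add // /D 2!mulnDl -addnA.
  have Bk : B + k * G + (K * N ^ d) <= Bm.
    by apply: leq_trans (Bs _ kN); rewrite mulSn; lia.
  have BmM : Bm <= M by rewrite /M leq_addl.
  rewrite addnA -addnA addnA leq_add //; first apply: leq_add.
  - by apply: leq_trans tg _; rewrite leq_mul //; lia.
  - apply: leq_trans T1 _; rewrite leq_mul // expnS.
    apply: leq_trans (_ : M ^ d <= _); last by rewrite leq_pmull.
    by rewrite leq_exp2rW // leq_add2l; lia.
  have {}T2 : eu <= Ku * M by apply: leq_trans T2 _; rewrite leq_mul2l; lia.
  have {}L2 : blen (den cle p s' x 0 + 1) <= Ku + M.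
    by apply: leq_trans L2 _; rewrite leq_add2l; lia.
  apply: leq_trans (_ : (Ku + Ku + 3) * M <= _); last by rewrite leq_mul2l MM orbT.
  have := leq_pmulr Ku M0; rewrite (_ : blen 0 = 1) // !mulnDl; lia.
have [||||[t E T] B1] := loop (s 0 h) 0 (update s x 0 0).
- by [].
- by rewrite /update !eqxx.
- by move=> i; rewrite update_neq // eq_sym.
- by apply: bounded_update; rewrite mul0n addn0.
split; last first.
  apply: boundedW B1; apply: leq_trans (Bs _ hN) _; rewrite leq_add2l.
  by rewrite leq_poly ?leq_addl //; lia.
exists (1 + 1 + blen 0 + blen 0 + t); first by apply: Exec_seq E; apply: Exec_assign.
have DC : D <= C * (N + B) ^ (d.+2 * d.+1).
  rewrite /D /C -mulnA leq_mul2l; apply/orP; right.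
  apply: leq_trans (_ : (K.+2 * (N + B) ^ d.+2) ^ d.+1 <= _); last by rewrite expnMn -expnM.
  by rewrite leq_exp2rW // leq_compose.
apply: leq_trans (_ : (4 + 2 * C) * (N + B) ^ (d.+2 * d.+2) <= _); last first.
  by rewrite leq_mul2r leq_addr orbT.
rewrite mulnDl leq_add //; first by rewrite (_ : blen 0 = 1) // leq_pmulr // expn_gt0 NB0.
apply: leq_trans T _; apply: leq_trans (_ : 2 * N * (C * (N + B) ^ (d.+2 * d.+1)) <= _).
  by rewrite leq_mul //; lia.
rewrite -(mulnA 2 N) -(mulnA 2 C) leq_mul2l /= mulnCA leq_mul2l; apply/orP; right.
apply: leq_trans (_ : (N + B) * (N + B) ^ (d.+2 * d.+1) <= _).
  by rewrite leq_mul // leq_addr.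
by rewrite -expnS leq_pexp2l // (mulnS _ d.+1) addnC; lia.
Qed.

Lemma poly_time_ex p : wf p -> exists K d, poly_time p K d.
Proof.
elim: p => [_|a i e|p IHp q IHq /andP[wp wq]|e p IHp q IHq /and3P[me wp wq]|x h p IHp wp].
- exists 1, 0 => cle s N B N0 _ _ sB; split; last by apply: boundedW sB; rewrite leq_addr.
  by exists 1; [exact: Exec_skip | rewrite expn0].
- case/and3P=> a0 /eval_bound[Ki Hi] /eval_bound[Ke He].
  exists (Ki + Ke + (Ki + Ke) + 2), 1 => cle s N B N0 _ _ sB; have B0 := bounded_gt0 sB.
  have [ti li] := Hi cle s B sB; have [te le] := He cle s B sB.
  rewrite !expn1; split; last first.
    apply: bounded_update; first by apply: boundedW sB; rewrite leq_addr.
    apply: leq_trans le _; rewrite addnC leq_add2l.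
    by apply: leq_trans (leq_pmulr _ N0); lia.
  eexists; first exact: Exec_assign.
  have ki : Ki <= Ki * B by rewrite leq_pmulr.
  have ke : Ke <= Ke * B by rewrite leq_pmulr.
  apply: leq_trans (_ : (Ki + Ke + (Ki + Ke) + 2) * B <= _); last first.
    by rewrite leq_mul2l leq_addl orbT.
  by rewrite !mulnDl; lia.
- have [Kp [dp Hp]] := IHp wp; have [Kq [dq Hq]] := IHq wq.
  by eexists; eexists; apply: poly_time_seq Hp Hq.
- have [Kp [dp Hp]] := IHp wp; have [Kq [dq Hq]] := IHq wq.
  have [Ke He] := eval_bound me.
  exists (Ke + Kp + Kq), (1 + dp + dq) => cle s N B N0 s0 s1 sB.
  have NB0 : 0 < N + B by rewrite addn_gt0 N0.
  have [te _] := He cle s B sB.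
  have [[t1 E1 T1] B1] := Hp cle s N B N0 s0 s1 sB.
  have [[t2 E2 T2] B2] := Hq cle s N B N0 s0 s1 sB.
  have {}te : eval_time cle s e <= Ke * (N + B) ^ (1 + dp + dq).
    apply: leq_trans te _; rewrite leq_mul2l; apply/orP; right.
    apply: leq_trans (leq_addl N B) _; rewrite -{1}(expn1 (N + B)) leq_pexp2l //; lia.
  rewrite /=; case: eqP => [ez|/eqP en]; split.
  + exists (eval_time cle s e + t2); first exact: Exec_if_false.
    rewrite -addnA mulnDl leq_add //; apply: leq_trans T2 _.
    by rewrite leq_poly //; lia.
  + by apply: boundedW B2; rewrite leq_add2l leq_poly //; lia.
  + exists (eval_time cle s e + t1); first exact: Exec_if_true.
    rewrite -addnA mulnDl leq_add //; apply: leq_trans T1 _.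
    by rewrite leq_poly //; lia.
  + by apply: boundedW B1; rewrite leq_add2l leq_poly //; lia.
have [|K [d Hp]] := IHp; first by case/and4P: wp.
exact: poly_time_for Hp.
Qed.

End Time.

(** * Growing shortcut Eulerian walks *)

Section Insertion.

Variable V : finType.
Implicit Types (u v x y : V) (w q : seq V) (nxt : V -> V).

Lemma first_occurrence (T : eqType) (u : T) (s : seq T) :
  u \in s -> exists s1 s2, s = s1 ++ u :: s2 /\ u \notin s1.
Proof.
elim: s => // x s IHs; rewrite inE; have [<- _|ux /= /IHs] := eqVneq u x.
  by exists [::], s.
by case=> s1 [s2 [-> us1]]; exists (x :: s1), s2; rewrite inE negb_or ux.
Qed.

Lemma walk_insert w1 w2 u v e :
  walk_graph (w1 ++ u :: v :: u :: w2) e =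
  walk_graph (w1 ++ u :: w2) e + 2 * (e == uv u v).
Proof.
rewrite !ffunE; case: w1 => [|x w1]; rewrite ?cat0s ?cat_cons !walk_edges_cons.
  by rewrite /= (uvC v u) (eq_sym e) /=; lia.
rewrite !rcons_cat /= !path_edges_cat /= !count_cat /= (uvC v u) (eq_sym e).
by lia.
Qed.

(* Replacing the first visit of u in a walk by the detour u v u places v right
   after u in the shortcut. *)
Definition insert_next nxt u v x : V :=
  if x == u then v else if x == v then nxt u else nxt x.

Lemma eq_in_fpath (f g : V -> V) x s :
  {in belast x s, f =1 g} -> fpath f x s -> fpath g x s.
Proof.
elim: s x => //= y s IHs x fg /andP[/eqP fx Ps].
rewrite -fg ?mem_head // fx eqxx IHs // => z zs.
by apply: fg; rewrite inE zs orbT.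
Qed.

Lemma fcycle_insert nxt q1 q2 u v :
  uniq (q1 ++ u :: q2) -> v \notin q1 ++ u :: q2 ->
  fcycle nxt (q1 ++ u :: q2) ->
  fcycle (insert_next nxt u v) (q1 ++ u :: v :: q2).
Proof.
(* Rotating u to the front turns both cycles into paths from u, which agree beyond the inserted
   v. *)
rewrite -(rot_uniq (size q1)) -(mem_rot (size q1)) -[fcycle nxt _](rot_cycle (size q1)).
rewrite -[fcycle (insert_next _ _ _) _](rot_cycle (size q1)).
rewrite !rot_size_cat /=; move: (q2 ++ q1) => s /andP[us Us].
rewrite inE negb_or => /andP[vu vs] Cs.
rewrite {1}/insert_next !eqxx /=.
have eqs z : z \in s -> nxt z = insert_next nxt u v z.
  move=> zs; rewrite /insert_next; have [zu|_] := eqVneq z u; first by rewrite -zu zs in us.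
  by have [zv|//] := eqVneq z v; rewrite -zv zs in vs.
case: s us vs Us Cs eqs => [|y s] /= us vs Us /andP[nu Cs] eqs.
  by rewrite /insert_next (negPf vu) eqxx nu.
rewrite {1}/insert_next (negPf vu) eqxx nu /=.
apply: eq_in_fpath Cs => z; rewrite belast_rcons; exact: eqs.
Qed.

(** The shortcut keeps the first visit of u, then the new vertex v, and drops the second u as a
    repetition; hence the detour must be made at the first visit. *)
Lemma shortcut_insert w1 w2 u v :
  u \notin w1 -> v \notin w1 ++ u :: w2 ->
  exists q1 q2, shortcut (w1 ++ u :: w2) = q1 ++ u :: q2 /\
    shortcut (w1 ++ u :: v :: u :: w2) = q1 ++ u :: v :: q2.
Proof.
move=> uw1; rewrite mem_cat inE !negb_or => /and3P[vw1 vu vw2].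
exists (shortcut w1), [seq y <- [seq y <- shortcut w2 | y != u] | y \notin w1].
rewrite !shortcut_cat !shortcut_cons /= uw1 vu /= vw1; split=> //.
rewrite (eq_sym u v) vu /= eqxx /=; congr (_ ++ _ :: _ :: _); congr filter.
rewrite -!filter_predI; apply: eq_in_filter => y.
rewrite mem_shortcut /= => yw2; case: eqP => //= _.
by rewrite andbT; apply: contra vw2 => /eqP<-.
Qed.

Lemma fcycle_rot1 nxt q : fcycle nxt q -> rot 1 q = map nxt q.
Proof.
case: q => // x q /= Pq; rewrite rot1_cons.
have Em s y : fpath nxt y s -> s = map nxt (belast y s).
  by elim: s y => //= z s IHs y /andP[/eqP-> /IHs{1}->].
by rewrite {1}(Em _ _ Pq) belast_rcons.
Qed.

(** The edges of a cycle are determined by its vertices and their successors, so storing successors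
    suffices for the output. *)
Lemma walk_edges_fcycle nxt q :
  fcycle nxt q -> walk_edges q = [seq uv x (nxt x) | x <- q].
Proof.
by move=> Cq; rewrite /walk_edges (fcycle_rot1 Cq); elim: q {Cq} => //= x q ->.
Qed.

End Insertion.

Section Grow.

Variables (V : finType) (F : {set edge V}) (lab : V -> V).
Hypothesis labF : labels F lab.
Hypothesis cardF : #|F| + #|components F| = #|V|.
Hypothesis lab_idem : forall v, lab (lab v) = lab v.
Implicit Types (u v x y : V) (P : {set V}) (nxt : V -> V).

Lemma no_loop x : uv x x \notin F.
Proof.
apply/negP => Fx; have := forest_card cardF (s := [:: x]) isT.
by rewrite /= fadjE Fx => /(_ isT).
Qed.

(** Otherwise one edge less would give no more components, against [leq_card_components] and
    [cardF]. *)
Lemma bridge u v : uv u v \in F -> ~~ connect (fadj (F :\ uv u v)) u v.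
Proof.
move=> Fuv; apply/negP => cuv.
have := leq_card_components (F :\ uv u v); rewrite -cardF (cardsD1 (uv u v) F) Fuv.
rewrite addSn leqNgt ltnS leq_add2l leq_components // => x y.
have [/eqP|ne Fxy] := eqVneq (uv x y) (uv u v); last first.
  by rewrite connect1 // fadjE in_setD1 ne.
by rewrite uv_eq => /orP[] /andP[/eqP-> /eqP->] //; rewrite fconn_sym.
Qed.

Definition block P x : {set V} := [set y in P | lab y == x].

(* Within P, each component of F has an Eulerian walk, here with its root
   repeated at the end (hence the extra loop), that shortcuts to nxt. *)
Definition grown P nxt : Prop :=
  (forall v, lab v \in P) /\
  forall x, lab x = x -> exists w,
    [/\ last x w = x, x :: w =i block P x,
        forall e, walk_graph (x :: w) e =
          doubled (edges_in F (block P x)) e + (e == loop x)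
      & fcycle nxt (shortcut (x :: w))].

(** A root alone has the closed walk of length one, whose only edge is the extra loop in [grown]. *)
Lemma grown_roots : grown [set v | lab v == v] id.
Proof.
split=> [v|x lx]; first by rewrite inE lab_idem.
have Bx : block [set v | lab v == v] x = [set x].
  apply/setP=> y; rewrite !inE; apply/andP/eqP => [[/eqP ly ylx]|->].
    by rewrite -ly; apply/eqP.
  by rewrite lx eqxx.
exists [::]; split=> // [y|e|]; rewrite ?Bx ?inE //; last by rewrite /= eqxx.
rewrite !ffunE /= addn0 /loop eq_sym.
suff -> : edges_in F [set x] = set0 by rewrite inE.
apply/setP=> f; rewrite !inE; apply/andP => -[]; have [a [b ->]] := edgeP f.
move=> Fab /subsetP sub.
have := sub a; have := sub b; rewrite !in_uv !eqxx orbT !inE.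
move=> /(_ isT)/eqP bx /(_ isT)/eqP ax.
by have := no_loop x; rewrite -{1}ax -bx Fab.
Qed.

(** Only the walk in the component of u changes, by the detour u v u. The other walks avoid u and v,
    the only places where the successor changes. *)
Lemma grown_insert P nxt u v :
  grown P nxt -> uv u v \in F -> u \in P -> v \notin P ->
  grown (v |: P) (insert_next nxt u v).
Proof.
case=> rootP walkP Fuv uP vP; split=> [y|x lx]; first by rewrite inE rootP orbT.
have luv : lab u = lab v by apply/eqP; rewrite -labF connect1.
have [w [lw wB wE Cw]] := walkP x lx.
have vw : v \notin x :: w by rewrite wB inE negb_and vP.
have [ux|ux] := eqVneq (lab u) x; last first.
  have BE : block (v |: P) x = block P x.
    apply/setP=> y; rewrite !inE; case: (eqVneq y v) => // ->.
    by rewrite -luv (negPf ux) !andbF.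
  exists w; rewrite BE; split=> //.
  have uw : u \notin x :: w by rewrite wB inE (negPf ux) andbF.
  have uq : u \notin shortcut (x :: w) by rewrite mem_shortcut.
  have vq : v \notin shortcut (x :: w) by rewrite mem_shortcut.
  case: (shortcut (x :: w)) uq vq Cw => //= y q uq vq.
  apply: eq_in_fpath => z; rewrite belast_rcons /insert_next => zq.
  have [zu|_] := eqVneq z u; first by rewrite -zu zq in uq.
  by have [zv|//] := eqVneq z v; rewrite -zv zq in vq.
have uw : u \in x :: w by rewrite wB inE uP ux eqxx.
have BE : block (v |: P) x = v |: block P x.
  apply/setP=> y; rewrite !inE; case: (eqVneq y v) => // ->.
  by rewrite -luv ux eqxx.
have [s1 [s2 [Es us1]]] := first_occurrence uw.
(* The extended walk still starts and ends at x: if [s1] is empty, then u is x itself. *)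
have [w' [Ew' lw']] : exists w', x :: w' = s1 ++ u :: v :: u :: s2 /\ last x w' = x.
  have : last x (s1 ++ u :: v :: u :: s2) = x.
    by rewrite last_cat /= -[RHS]lw -[last x w]/(last x (x :: w)) Es last_cat.
  case: s1 Es {us1} => [|y s1] /= [<- _] ls; first by exists (v :: x :: s2).
  by exists (s1 ++ u :: v :: u :: s2).
exists w'; rewrite Ew' BE; split=> //.
- move=> y; rewrite in_setU1 -wB Es !(mem_cat, inE).
  by case: (y == u); case: (y == v); rewrite ?orbT.
- move=> e; rewrite walk_insert -Es wE !ffunE -addnA (addnC (e == _ : nat)) addnA.
  congr (_ + _); rewrite -mulnDr; congr (2 * _).
  have vB : v \notin block P x by rewrite inE negb_and vP.
  (* v is a leaf: a second edge to the block would close a cycle with the walk. *)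
  have BF a : a \in block P x -> uv a v \in F -> a = u.
    rewrite -wB => aw Fav; apply/eqP/negPn/negP => au.
    have := bridge Fuv; case/negP.
    apply: connect_trans (_ : connect _ u a) (connect1 _); last first.
      by rewrite fadjE in_setD1 uv_eq (negPf au) Fav andbT /=; case: eqP aw vw => // -> ->.
    apply: connect_sub (walk_connected uw aw) => b c; rewrite adjE wE ffunE.
    have [/eqP|_] := eqVneq (uv b c) (loop x).
      by rewrite eq_loop => /andP[/eqP-> /eqP->].
    rewrite addn0 muln_gt0 lt0b /= inE => /andP[Fbc /subsetP sub].
    apply: connect1; rewrite fadjE in_setD1 Fbc andbT uv_eq.
    have := sub b; have := sub c; rewrite !in_uv !eqxx orbT => /(_ isT) cB /(_ isT) bB.
    by apply/negP => /orP[] /andP[/eqP Eb /eqP Ec]; rewrite -?Eb -?Ec ?bB ?cB in vB.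
  have [->|ne] := eqVneq e (uv u v).
    have -> : uv u v \in edges_in F (v |: block P x).
      rewrite inE Fuv; apply/subsetP=> y; rewrite in_uv !inE.
      by case/orP=> /eqP->; rewrite ?eqxx // uP ux eqxx orbT.
    suff /negPf-> : uv u v \notin edges_in F (block P x) by [].
    rewrite inE Fuv; apply/negP => /subsetP/(_ v).
    by rewrite in_uv eqxx orbT (negPf vB) => /(_ isT).
  rewrite addn0; congr nat_of_bool; rewrite !inE; case: (boolP (e \in F)) => //= Fe.
  apply/subsetP/subsetP => sub y ye; first by rewrite in_setU1 sub ?orbT.
  have := sub y ye; rewrite in_setU1 => /orP[/eqP yv|//].
  have [a [b eab]] := edgeP e; move: ne ye sub Fe; rewrite {y}yv eab.
  rewrite in_uv => ne /orP[] /eqP Ev sub; subst; last first.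
    have := sub a; rewrite in_uv eqxx in_setU1 => /(_ isT) /orP[/eqP->|aB Fav].
      by rewrite (negPf (no_loop _)).
    by rewrite (BF a aB Fav) eqxx in ne.
  have := sub b; rewrite in_uv eqxx orbT in_setU1 => /(_ isT) /orP[/eqP->|bB].
    by rewrite (negPf (no_loop _)).
  by rewrite uvC => Fbv; rewrite (BF b bB Fbv) uvC eqxx in ne.
have vs : v \notin s1 ++ u :: s2 by rewrite -Es.
have [q1 [q2 [Eq ->]]] := shortcut_insert us1 vs.
rewrite Es in Cw; apply: fcycle_insert; rewrite -Eq //; first exact: shortcut_uniq.
by rewrite mem_shortcut.
Qed.

(** Membership in P is constant on components, and P contains every root. *)
Lemma grown_full P nxt : grown P nxt ->
  (forall u v, uv u v \in F -> u \in P -> v \in P) -> P = setT.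
Proof.
case=> rootP _ PF; apply/setP=> v; rewrite inE.
have : connect (fadj F) (lab v) v by rewrite labF lab_idem.
move=> c; rewrite -(connect_const (g := fun x => x \in P) _ c) ?rootP // => x y Fxy.
by apply/idP/idP; apply: PF; rewrite // uvC.
Qed.

(** Dropping the repeated root at the end removes the extra loop. On a singleton, the closed walk of
    length one is just the single loop that the algorithm prescribes. *)
Lemma grown_cycle nxt x : grown setT nxt -> lab x = x ->
  exists q, [/\ uniq q, q =i [set y | lab y == x], fcycle nxt q
    & cycle_of (edges_in F [set y | lab y == x]) [set y | lab y == x] (walk_graph q)].
Proof.
move=> [_ walkT] lx; have [w [lw wB wE Cw]] := walkT x lx.
have BE : block setT x = [set y | lab y == x].
  by apply/setP=> y; rewrite !inE.
rewrite BE in wB wE; exists (shortcut (x :: w)); split=> //.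
- exact: shortcut_uniq.
- by move=> y; rewrite mem_shortcut wB.
rewrite /cycle_of; case: ifP => [W2|W1].
  case/lastP: w lw wB wE Cw => [_ wB|w z].
    by move: W2; rewrite -(eq_card wB); have /card_uniqP-> : uniq [:: x].
  rewrite last_rcons => -> wB wE Cw; exists (x :: w); split.
    apply/ffunP=> e; have := wE e; rewrite !ffunE !walk_edges_cons.
    rewrite -(cats1 (rcons w x)) path_edges_cat count_cat last_rcons /= addn0.
    by rewrite (eq_sym e) => /addIn.
  by rewrite -rcons_cons shortcut_rcons mem_head.
exists x; have Wx : [set y | lab y == x] = [set x].
  apply/eqP; rewrite eq_sym eqEcard cards1 leqNgt W1 andbT.
  by apply/subsetP=> y; rewrite !inE => /eqP->; rewrite lx.
split=> //; apply/ffunP=> e.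
have : perm_eq (shortcut (x :: w)) [:: x].
  apply: uniq_perm; rewrite ?shortcut_uniq // => y.
  by rewrite mem_shortcut wB Wx !inE.
by move=> /perm_small_eq-> //; rewrite !ffunE /= addn0 eq_sym.
Qed.

End Grow.

(** * From successors and component numbers to an outcome of the algorithm *)

Section Outcome.

Variables (R : realFieldType) (V : finType) (I : instance R V).
Variables (F : {set edge V}) (lab nxt : V -> V) (idx : V -> nat).
Local Notation m := (agents I).
Hypotheses (labF : labels F lab) (lab_idem : forall v, lab (lab v) = lab v).
Hypotheses (optF : greedy_opt I m F) (grownF : grown F lab setT nxt).
Hypotheses (idx_lt : forall v, idx v < m).
Hypothesis idx_inj : forall u v, (idx u == idx v) = (lab u == lab v).

Let W (i : 'I_m) : {set V} := [set v | idx v == i].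
(** Every vertex contributes the edge to its successor: this gives two parallel edges on two
    vertices and a loop at a fixed point of [nxt]. *)
Let H (i : 'I_m) : multigraph V := [ffun e => \sum_(x in W i) (uv x (nxt x) == e)].
Let pick v : 'I_m := Ordinal (idx_lt v).

(** Every component occurs as some [W i]; as there are m components for m indices, injectivity
    follows by counting. *)
Lemma components_image : W @: [set: 'I_m] = components F /\ injective W.
Proof.
have [cF _ _] := optF.
have sub : components F \subset W @: [set: 'I_m].
  apply/subsetP=> _ /imsetP[v _ ->]; apply/imsetP; exists (pick v) => //.
  by apply/setP=> u; rewrite !inE labF /= idx_inj eq_sym.
have cW : #|W @: [set: 'I_m]| <= m.
  by apply: leq_trans (leq_imset_card _ _) _; rewrite cardsT card_ord.
have EW : W @: [set: 'I_m] = components F.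
  by apply/esym/eqP; rewrite eqEcard sub cF.
split=> //; suff /imset_injP Winj : #|W @: [set: 'I_m]| == #|[set: 'I_m]|.
  by move=> i j; apply: Winj.
by rewrite EW cF cardsT card_ord.
Qed.

Lemma index_class i : exists x, lab x = x /\ W i = [set y | lab y == x].
Proof.
have [EW _] := components_image.
have : W i \in components F by rewrite -EW imset_f.
case/imsetP=> v _ ->; exists (lab v); rewrite lab_idem; split=> //.
by apply/setP=> u; rewrite !inE labF eq_sym.
Qed.

Lemma outcome_cycle i : exists q,
  [/\ uniq q, q =i W i, fcycle nxt q, H i = walk_graph q
    & cycle_of (edges_in F (W i)) (W i) (H i)].
Proof.
have cardF : #|F| + #|components F| = #|V| by case: optF => -> ->.
have [x [lx Wx]] := index_class i.
have [q [Uq qW Cq cyc]] := grown_cycle grownF lx.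
have EH : H i = walk_graph q.
  apply/ffunP=> e; rewrite !ffunE (walk_edges_fcycle Cq) count_map -sum1_count.
  rewrite [RHS]big_mkcond [RHS]big_uniq //=; apply: eq_big => [y|y _]; first by rewrite Wx qW.
  by case: eqP.
by exists q; split; rewrite ?EH // Wx.
Qed.

Lemma nxt_idx v : idx (nxt v) = idx v.
Proof.
have [q [_ qW Cq _ _]] := outcome_cycle (pick v).
have vq : v \in q by rewrite qW inE.
have : nxt v \in q by rewrite -(mem_rot 1) (fcycle_rot1 Cq) map_f.
by rewrite qW inE => /eqP.
Qed.

Lemma algorithm_outcome : m <= #|V| -> m <= total_request I ->
  algorithm (Some (add_loops H pick)).
Proof.
move=> mV mr; have [EW Winj] := components_image.
apply: (Alg_forest (F := F) (W := W)) => //.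
- exact: greedy_opt_min.
- by move=> i; have [q []] := outcome_cycle i.
move=> v; have [q [Uq qW _ -> _]] := outcome_cycle (pick v).
by rewrite in_set degree_walk muln_gt0 -has_count has_pred1 qW in_set /=.
Qed.

(** The closed form that [tree_entry] evaluates. Testing the index of u is enough because successors
    stay in the component; both terms of the last sum count when u and v succeed each other. *)
Lemma outcome_edge i u v :
  add_loops H pick i (uv u v) =
  if idx u == i then
    if u == v then (nxt u == u) + (request I u - 1)
    else (nxt u == v) + (nxt v == u)
  else 0.
Proof.
rewrite !ffunE; have [<-|uv'] := eqVneq u v.
  have -> : \sum_(x in W i) (uv x (nxt x) == uv u u) = (idx u == i) && (nxt u == u).
    rewrite big_mkcond (bigD1 u) //= inE eq_loop eqxx /= big1 ?addn0.
      by case: (_ == _).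
    by move=> x /negPf xu; rewrite eq_loop xu; case: ifP.
  have -> : \sum_(x | pick x == i) (if uv u u == loop x then request I x - 1 else 0) =
      if idx u == i then request I u - 1 else 0.
    rewrite big_mkcond (bigD1 u) //= eqxx big1 ?addn0 //.
    by move=> x; rewrite eq_loop eq_sym => /negPf->; case: ifP.
  by case: (idx u == i).
rewrite [X in _ + X]big1 ?addn0 => [|x _]; last first.
  rewrite eq_loop; case: eqP => // ux; case: eqP => // vx.
  by rewrite ux vx eqxx in uv'.
rewrite big_mkcond (bigD1 u) //= (bigD1 v) /=; last by rewrite eq_sym.
rewrite big1 ?addn0 => [|x /andP[/negPf xu /negPf xv]]; last first.
  by rewrite uv_eq xu xv; case: ifP.
rewrite !inE !uv_eq !eqxx (negPf uv') (eq_sym v u) (negPf uv') /= orbF.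
have [vu|_] := eqVneq (nxt v) u.
  have -> : idx v = idx u by rewrite -vu nxt_idx.
  by case: (idx u == i).
by case: (idx u == i); case: (idx v == i).
Qed.

End Outcome.

(** * Output and distribution of self-loops *)

(* Arrays 5 to 26 are working storage; a scalar variable is cell 0 of its array.
   The C* are loop counters, (BU, BV) is the cheapest edge found so far, EU and
   EV list the endpoints of the forest edges, REM and OWN distribute the
   self-loops in step (2), and P3, P4 run through the addresses of the output
   arrays 3 and 4, which avoids multiplications. *)
Local Notation TOT := 5.
Local Notation CV := 6.
Local Notation CU := 7.
Local Notation CK := 8.
Local Notation CI := 9.
Local Notation CW := 10.
Local Notation LAB := 11.
Local Notation BU := 12.
Local Notation BV := 13.
Local Notation EU := 14.
Local Notation EV := 15.
Local Notation LU := 16.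
Local Notation LV := 17.
Local Notation NEXT := 18.
Local Notation PLACED := 19.
Local Notation NUMBER := 20.
Local Notation COUNT := 21.
Local Notation REM := 22.
Local Notation OWN := 23.
Local Notation PICK := 24.
Local Notation P3 := 25.
Local Notation P4 := 26.

Definition var (a : nat) : expr := Cell a (Lit 0).
Definition set_var (a : nat) (e : expr) : fprog := FAssign a (Lit 0) e.
Definition EqE (e f : expr) : expr := Op Leq (Lit 2) (Op Add (Op Leq e f) (Op Leq f e)).
Definition LtE (e f : expr) : expr := Op Leq (Op Add e (Lit 1)) f.
Definition incr (a : nat) : fprog := set_var a (Op Add (var a) (Lit 1)).
Local Notation "p ;; q" := (FSeq p q) (at level 60, right associativity).

Definition sum_prog : fprog :=
  FFor CV 0 (set_var TOT (Op Add (var TOT) (Cell 1 (var CV)))).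

Definition pick_prog : fprog :=
  FFor CV 0 (FIf (Cell REM (var CV)) (set_var PICK (var CV)) FSkip).

(* The first n agents get one loop at vertices 0, ..., n-1, the others one loop
   wherever requests remain; what is left at v then goes to agent v. *)
Definition owner_init : fprog := FFor CV 0 (FAssign REM (var CV) (Cell 1 (var CV))).

Definition owner_choice : fprog :=
  FIf (LtE (var CI) (Cell 0 (Lit 0))) (set_var PICK (var CI)) FSkip.

Definition owner_update : fprog :=
  FAssign OWN (var CI) (var PICK) ;;
  FAssign REM (var PICK) (Op Defs.Sub (Cell REM (var PICK)) (Lit 1)).

Definition owner_step : fprog := pick_prog ;; owner_choice ;; owner_update.

Definition owner_prog : fprog := owner_init ;; FFor CI 1 owner_step.

Definition loop_entry : fprog :=
  FIf (EqE (var CU) (var CV))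
    (FIf (EqE (Cell OWN (var CI)) (var CU))
       (FIf (EqE (var CI) (var CU))
          (FAssign 4 (var P4) (Op Add (Lit 1) (Cell REM (var CU))))
          (FAssign 4 (var P4) (Lit 1)))
       (FAssign 4 (var P4) (Lit 0)))
    (FAssign 4 (var P4) (Lit 0)).

Definition output_body (entry : fprog) : fprog :=
  entry ;; FAssign 3 (var P3) (Op Add (Cell 3 (var P3)) (Cell 4 (var P4))) ;;
  incr P3 ;; incr P4.

(** [P3] restarts for every agent because array 3 accumulates over the agents, whereas [P4] runs
    through array 4 just once. *)
Definition output_prog (entry : fprog) : fprog :=
  FFor CI 1 (set_var P3 (Lit 0) ;; FFor CU 0 (FFor CV 0 (output_body entry))).

Section Basics.

Variable cle : nat -> nat -> nat -> nat -> bool.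
Local Notation den := (den cle).
Local Notation eval := (eval cle).

Lemma updateE s a i k b j :
  update s a i k b j = if (b == a) && (j == i) then k else s b j.
Proof. by []. Qed.

Lemma den_eq s e f p q :
  den (FIf (EqE e f) p q) s = if eval s e == eval s f then den p s else den q s.
Proof.
rewrite [in RHS]eqn_leq /=; move: (eval s e) (eval s f) => a b.
by case: (a <= b); case: (b <= a).
Qed.

Lemma den_lt s e f p q :
  den (FIf (LtE e f) p q) s = if eval s e < eval s f then den p s else den q s.
Proof. by rewrite /= addn1; case: leqP. Qed.

Lemma den_seq s p q : den (p ;; q) s = den q (den p s).
Proof. by []. Qed.

Lemma enc_inj k a b a' b' :
  b < k -> b' < k -> a * k + b = a' * k + b' -> a = a' /\ b = b'.
Proof.
move=> bk bk' E; have k0 : 0 < k by apply: leq_ltn_trans bk.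
split; last by rewrite -(modn_small bk) -(modnMDl a) E modnMDl modn_small.
have := congr1 (divn^~ k) E.
by rewrite !divnMDl // !divn_small // !addn0.
Qed.

Lemma enc_lt n u v : u < n -> v < n -> u * n + v < n * n.
Proof.
move=> un vn; apply: leq_trans (_ : u * n + n <= _); first by rewrite ltn_add2l.
by rewrite -mulSnr leq_mul2r un orbT.
Qed.

Lemma den_sum s : s TOT 0 = 0 -> den sum_prog s TOT 0 = \sum_(0 <= j < s 0 0) s 1 j.
Proof.
move=> t0; apply: (den_for (J := fun k s' => s' TOT 0 = \sum_(0 <= j < k) s 1 j)) => //.
  by rewrite big_geq.
move=> k s' _ ck fr Jk; rewrite big_nat_recr //= -Jk -(fr 1 k) //.
by rewrite /tick !updateE /= ck.
Qed.

Section Output.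

Variables (entry : fprog) (s : memory) (g : nat -> nat -> nat -> nat).
Local Notation n := (s 0 0).
Hypothesis wr : all (pred1 4) (writes entry).
Hypothesis entryP : forall s',
  (forall a j, a \notin [:: 3; 4; CV; CU; CI; P3; P4] -> s' a j = s a j) ->
  s' CU 0 < n -> s' CV 0 < n -> s' CI 0 < s 0 1 ->
  forall b j, den entry s' b j =
    update s' 4 (s' P4 0) (g (s' CI 0) (s' CU 0) (s' CV 0)) b j.

Lemma entry_writes a : a != 4 -> (a \in writes entry) = false.
Proof. by move=> a4; apply/negbTE; apply: contra a4 => /(allP wr). Qed.

(** Here c counts the cells of agent i already passed in row-major order; array 3 is ahead by the
    entries of agent i exactly there. *)
Let partial i c (s' : memory) : Prop :=
  [/\ s' P4 0 = i * (n * n) + c,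
      forall i' u v, u < n -> v < n ->
        i' * (n * n) + (u * n + v) < i * (n * n) + c ->
        s' 4 (i' * (n * n) + (u * n + v)) = g i' u v
    & forall u v, u < n -> v < n -> s' 3 (u * n + v) =
        \sum_(0 <= j < i) g j u v + (if u * n + v < c then g i u v else 0)].

Let partial_ext i c s1 s2 :
  (forall a j, a \in [:: 3; 4; P4] -> s2 a j = s1 a j) ->
  partial i c s1 -> partial i c s2.
Proof.
move=> E [p4 A4 A3]; split=> [|i' u v un vn lt|u v un vn]; rewrite E //.
  exact: A4.
exact: A3.
Qed.

Let partial_next i s' : partial i (n * n) s' -> partial i.+1 0 s'.
Proof.
case=> p4 A4 A3; split=> [|i' u v un vn|u v un vn].
- by rewrite p4 addn0 mulSnr.
- by rewrite addn0 mulSnr; apply: A4.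
by rewrite A3 // big_nat_recr //= enc_lt // addn0.
Qed.

Let partial_step i u v s' :
  (forall a j, a \notin [:: 3; 4; CV; CU; CI; P3; P4] -> s' a j = s a j) ->
  i < s 0 1 -> u < n -> v < n -> s' CI 0 = i -> s' CU 0 = u -> s' CV 0 = v ->
  s' P3 0 = u * n + v -> partial i (u * n + v) s' ->
  let s'' := den (output_body entry) s' in
  s'' P3 0 = u * n + v.+1 /\ partial i (u * n + v.+1) s''.
Proof.
move=> fr im un vn ci cu cv p3 [p4 A4 A3].
have := entryP fr; rewrite ci cu cv => /(_ un vn im) eP.
move=> s''; pose a3 := u * n + v; pose a4 := i * (n * n) + a3.
have E b j : s'' b j =
    if (b == P4) && (j == 0) then a4.+1 else if (b == P3) && (j == 0) then a3.+1
    else if (b == 3) && (j == a3) then s' 3 a3 + g i u v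
    else if (b == 4) && (j == a4) then g i u v else s' b j.
  by rewrite /s'' /= !(updateE, eP) /= p3 p4 !eqxx /= !addn1.
rewrite /partial !E /= !addnS; split=> //; split=> // [i' u' v' un' vn'|u' v' un' vn'].
  rewrite E /= ltnS leq_eqVlt => /orP[/eqP E4|lt].
    have [-> E3] := enc_inj (enc_lt un' vn') (enc_lt un vn) E4.
    by have [-> ->] := enc_inj vn' vn E3; rewrite eqxx.
  by rewrite (ltn_eqF lt); apply: A4.
rewrite E /= ltnS leq_eqVlt.
have [E3|ne] /= := eqVneq (u' * n + v') (u * n + v); last by rewrite A3.
have [-> ->] := enc_inj vn' vn E3.
by rewrite A3 // ltnn addn0.
Qed.

Lemma den_output :
  s P4 0 = 0 -> (forall j, s 3 j = 0) ->
  let s' := den (output_prog entry) s in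
  (forall i u v, i < s 0 1 -> u < n -> v < n -> s' 4 ((i * n + u) * n + v) = g i u v) /\
  (forall u v, u < n -> v < n -> s' 3 (u * n + v) = \sum_(0 <= i < s 0 1) g i u v).
Proof.
move=> p40 A30.
have wrE a : a \notin [:: 3; 4; CV; CU; CI; P3; P4] -> a \notin writes (output_prog entry).
  rewrite /= !inE mem_cat !inE !negb_or => /and5P[-> a4 -> -> /and3P[-> -> ->]] /=.
  by rewrite entry_writes.
suff [p4 A4 A3] : partial (s 0 1) 0 (den (output_prog entry) s).
  split=> [i u v im un vn|u v un vn]; last by rewrite A3 // ltn0 addn0.
  have -> : (i * n + u) * n + v = i * (n * n) + (u * n + v).
    by rewrite mulnDl mulnA addnA.
  apply: A4 => //; rewrite addn0.
  apply: leq_trans (_ : i * (n * n) + n * n <= _); first by rewrite ltn_add2l enc_lt.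
  by rewrite -mulSnr leq_mul2r im orbT.
apply: (den_for (J := fun i => partial i 0)).
- by rewrite /= !inE mem_cat !inE entry_writes.
- split=> [|//|u v _ _]; first by rewrite updateE.
  by rewrite updateE /= A30 big_geq.
move=> i s' im ci fr Pi.
suff : partial i (n * n)
    (den (set_var P3 (Lit 0) ;; FFor CU 0 (FFor CV 0 (output_body entry))) s').
  move/partial_next; apply: partial_ext => a j; rewrite /tick updateE.
  by case: eqP => // ->.
rewrite den_seq; set s1 := den (set_var _ _) s'.
have n0 : s1 0 0 = n.
  rewrite -(fr 0) // -/(writes (output_prog entry)); exact: wrE.
have fr1 a j : a \notin [:: 3; 4; CV; CU; CI; P3; P4] -> s1 a j = s a j.
  move=> a4; have a25 : (a == P3) = false.
    by move: a4; rewrite !inE !negb_or => /and5P[_ _ _ _ /and3P[_ /negPf]].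
  rewrite /s1 /= updateE a25 /=.
  by apply: fr; apply: wrE.
pose J u s2 := s2 P3 0 = u * n /\ partial i (u * n) s2.
suff : J (s1 0 0) (den (FFor CU 0 (FFor CV 0 (output_body entry))) s1).
  by rewrite n0; case.
apply: den_for; rewrite /J.
- by rewrite /= !inE mem_cat !inE entry_writes.
- rewrite mul0n; split; first by rewrite updateE.
  by apply: partial_ext Pi => a j; rewrite !inE => /or3P[] /eqP->.
move=> u s2 un cu fr2 [p3 Pu]; rewrite n0 in un.
have n2 : s2 0 0 = n by rewrite fr2 // /= !inE mem_cat !inE entry_writes.
pose Jv v s3 := s3 P3 0 = u * n + v /\ partial i (u * n + v) s3.
suff : Jv (s2 0 0) (den (FFor CV 0 (output_body entry)) s2).
  rewrite n2 /Jv -mulSnr => -[q3 Pn]; split; first by rewrite /tick updateE.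
  apply: partial_ext Pn => a j; rewrite /tick updateE.
  by case: eqP => // ->.
apply: den_for; rewrite /Jv.
- by rewrite /= mem_cat !inE entry_writes.
- rewrite addn0; split; first by rewrite updateE.
  apply: partial_ext Pu => a j; rewrite updateE.
  by case: eqP => // ->.
move=> v s3 vn cv fr3 [p3v Pv]; rewrite n2 in vn.
have wbody a : a \notin [:: 3; 4; CV; CU; CI; P3; P4] ->
    ((a \notin writes (output_body entry)) * (a != CV) * (a != CU))%type.
  rewrite /= !inE mem_cat !inE !negb_or => /and5P[-> a4 -> -> /and3P[_ -> ->]].
  by rewrite entry_writes.
have [] := @partial_step i u v s3 _ im un vn _ _ cv p3v Pv.
- move=> a j aE; have [[w1 w2] w3] := wbody a aE.
  have -> : s3 a j = s2 a j by apply: fr3; rewrite inE negb_or w2 w1.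
  have -> : s2 a j = s1 a j; last exact: fr1.
  apply: fr2; rewrite -[writes (FFor _ _ _)]/(CV :: writes (output_body entry)).
  by rewrite !inE !negb_or w3 w2 w1.
- have fE : CI \notin writes (output_body entry) by rewrite /= mem_cat !inE entry_writes.
  by rewrite fr3 ?fr2 /s1 ?updateE //= inE ?negb_or ?fE // inE.
- have fE : CU \notin writes (output_body entry) by rewrite /= mem_cat !inE entry_writes.
  by rewrite fr3 ?inE.
move=> q3 Pv'; split; first by rewrite /tick updateE.
by apply: partial_ext Pv' => a j; rewrite /tick updateE; case: eqP => // ->.
Qed.

End Output.

End Basics.

(** * One self-loop for every agent *)

Section Owners.

Variable cle : nat -> nat -> nat -> nat -> bool.
Local Notation den := (den cle).

Lemma den_pick s :
  (exists2 v, v < s 0 0 & 0 < s REM v) ->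
  den pick_prog s PICK 0 < s 0 0 /\ 0 < s REM (den pick_prog s PICK 0).
Proof.
case=> v0 v0n rem0; pose J k (s' : memory) := forall v, v < k -> 0 < s REM v ->
  s' PICK 0 < s 0 0 /\ 0 < s REM (s' PICK 0).
suff : J (s 0 0) (den pick_prog s) by apply; [exact: v0n |].
apply: den_for => // k s' kn ck fr Jk v.
rewrite /tick !updateE /= ck fr //; have [r0|r0] /= := eqVneq (s REM k) 0.
  rewrite ltnS leq_eqVlt => /orP[/eqP-> | vk]; last exact: Jk.
  by rewrite r0.
by move=> _ _; rewrite updateE /= lt0n.
Qed.

Lemma sum_remaining n i (r rem : nat -> nat) (own : nat -> nat) :
  (forall j, j < i -> own j < n) ->
  (forall v, v < n -> r v = rem v + \sum_(0 <= j < i) (own j == v)) ->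
  \sum_(0 <= v < n) r v = \sum_(0 <= v < n) rem v + i.
Proof.
move=> ownn rE.
rewrite (eq_big_nat _ _ (F2 := fun v => rem v + \sum_(0 <= j < i) (own j == v))).
  2: by move=> v; exact: rE.
rewrite big_split /=.
congr (_ + _); rewrite exchange_big_nat /=.
rewrite (eq_big_nat _ _ (F2 := fun=> 1)) => [|j /ownn jn].
  by rewrite sum_nat_const_nat subn0 muln1.
rewrite big_mkord (bigD1 (Ordinal jn)) //= eqxx big1 // => v.
by rewrite -val_eqE /= eq_sym => /negPf->.
Qed.

(** As m is at most the total request, [sum_remaining] always leaves a loop to hand out. For i < n,
    vertex i still has its full request at the turn of agent i, the earlier agents having taken
    theirs elsewhere. *)
Lemma den_owner s :
  s 0 0 < s 0 1 -> s 0 1 <= \sum_(0 <= j < s 0 0) s 1 j ->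
  (forall v, v < s 0 0 -> 0 < s 1 v) ->
  let s' := den owner_prog s in
  [/\ forall i, i < s 0 1 -> s' OWN i < s 0 0,
      forall i, i < s 0 0 -> s' OWN i = i
    & forall v, v < s 0 0 ->
        s 1 v = s' REM v + \sum_(0 <= j < s 0 1) (s' OWN j == v)].
Proof.
set n := s 0 0; set m := s 0 1 => nm mr r0; cbv zeta.
rewrite /owner_prog den_seq; set s1 := den owner_init s.
have R1 : forall v, v < n -> s1 REM v = s 1 v.
  apply: (den_for (J := fun k s' => forall v, v < k -> s' REM v = s 1 v)) => //.
  move=> k s' kn ck fr Jk v; rewrite /tick /= !updateE /= ck ltnS leq_eqVlt.
  by have [->|ne] /= := eqVneq v k; [rewrite fr | apply: Jk].
have fr1 a j : a \notin writes owner_init -> s1 a j = s a j by apply: den_frame.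
pose J i (s' : memory) :=
  [/\ forall j, j < i -> s' OWN j < n, forall j, j < i -> j < n -> s' OWN j = j
    & forall v, v < n -> s 1 v = s' REM v + \sum_(0 <= j < i) (s' OWN j == v)].
suff : J (s1 0 1) (den (FFor CI 1 owner_step) s1).
  rewrite fr1 // => -[H1 H2 H3]; split=> // i ni; apply: H2 => //.
  exact: ltn_trans ni nm.
apply: den_for => //.
  by split=> // v vn; rewrite big_geq // addn0 updateE /= R1.
move=> i s2 im ci fr [H1 H2 H3]; rewrite fr1 // -/m in im.
have n2 : s2 0 0 = n by rewrite fr // fr1.
rewrite /owner_step den_seq; set s3 := den pick_prog s2.
have fr3 a j : a \notin writes pick_prog -> s3 a j = s2 a j by apply: den_frame.
rewrite den_seq; set s4 := den owner_choice s3.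
have fr4 a j : a != PICK -> s4 a j = s3 a j.
  move=> aP; rewrite /s4 /owner_choice den_lt.
  by case: ifP => //= _; rewrite updateE (negPf aP).
have [pn prem] : s4 PICK 0 < n /\ 0 < s2 REM (s4 PICK 0).
  rewrite /s4 /owner_choice den_lt /= !fr3 // ci n2; case: (ltnP i n) => [lin|ni].
    rewrite updateE /=; split=> //.
    suff E : \sum_(0 <= j < i) (s2 OWN j == i) = 0.
      by have := H3 i lin; rewrite E addn0 => <-; apply: r0.
    rewrite big_nat big1 // => j /andP[_ ji]; rewrite H2 ?(ltn_trans ji lin) //.
    by rewrite (ltn_eqF ji).
  rewrite -n2; apply: den_pick; rewrite n2.
  have Hs := sum_remaining H1 H3.
  have [//|no] := boolP [exists v : 'I_n, 0 < s2 REM v].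
    by case/existsP=> v v0; exists v.
  have : \sum_(0 <= v < n) s2 REM v = 0.
    rewrite big_nat big1 // => v /andP[_ vn]; apply/eqP; rewrite -leqn0 leqNgt.
    by move/existsPn: no => /(_ (Ordinal vn)).
  by move: Hs mr => -> /[swap] ->; rewrite add0n leqNgt im.
have pO : (if i < n then i else s4 PICK 0) = s4 PICK 0.
  by rewrite /s4 /owner_choice den_lt /= !fr3 // ci n2; case: (i < n).
set pk := s4 PICK 0 in pn prem pO.
have E b j : tick CI (den owner_update s4) b j =
    if (b == CI) && (j == 0) then i.+1 else
    if (b == REM) && (j == pk) then s2 REM pk - 1 else
    if (b == OWN) && (j == i) then pk else s4 b j.
  have c4 : s4 CI 0 = i by rewrite fr4 // fr3.
  have r4 x : s4 REM x = s2 REM x by rewrite fr4 // fr3.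
  by rewrite /tick /= !updateE /= !c4 r4 -/pk addn1.
rewrite /J den_seq; set t := tick CI _ in E *; split=> [j|j|v vn].
- rewrite E /= ltnS leq_eqVlt; have [//|ne /= ji] := eqVneq j i.
  by rewrite fr4 // fr3 // H1.
- rewrite E /= ltnS leq_eqVlt; have [-> _ lin|ne /= ji jn] := eqVneq j i.
    by rewrite -pO lin.
  by rewrite fr4 // fr3 // H2.
rewrite big_nat_recr //= !E.
rewrite (eq_big_nat _ _ (F2 := fun j => (s2 OWN j == v : nat))) => [|j /andP[_ ji]]; last first.
  by rewrite E /= (ltn_eqF ji) fr4 // fr3.
rewrite /= eqxx H3 //; have [->|ne] := eqVneq v pk.
  by rewrite [RHS]addnCA subnK // addnC.
by rewrite fr4 // fr3 // addn0.
Qed.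

End Owners.

(** * Vertices and their numbers in memory *)

Section Numbering.

Variables (V : finType) (x0 : V).

Definition num (v : V) : nat := enum_rank v.
Definition vx (k : nat) : V := nth x0 (enum V) k.

Lemma num_lt v : num v < #|V|.
Proof. exact: ltn_ord. Qed.

Lemma vxK v : vx (num v) = v.
Proof. exact: nth_enum_rank. Qed.

Lemma numK k : k < #|V| -> num (vx k) = k.
Proof.
move=> kn; have := enum_valK (Ordinal kn).
by rewrite (enum_val_nth x0) /num /vx /= => ->.
Qed.

Lemma num_eq u v : (num u == num v) = (u == v).
Proof. by rewrite val_eqE (inj_eq enum_rank_inj). Qed.

Lemma eq_vx k v : k < #|V| -> (vx k == v) = (k == num v).
Proof. by move=> kn; rewrite -num_eq numK. Qed.

Lemma num_ltS v k : k < #|V| -> (num v < k.+1) = (v == vx k) || (num v < k).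
Proof. by move=> kn; rewrite ltnS leq_eqVlt eq_sym -(eq_vx _ kn) eq_sym. Qed.

Lemma sum_num (f : nat -> nat) : \sum_(0 <= k < #|V|) f k = \sum_v f (num v).
Proof.
rewrite big_mkord (reindex (@enum_rank V)) //=.
by apply: onW_bij; exists enum_val; [apply: enum_rankK | apply: enum_valK].
Qed.

Variables (R : realFieldType) (I : instance R V).

Lemma input_request v : input I 1 (num v) = request I v.
Proof.
by rewrite /= (nth_map x0) ?vxK -?cardE ?num_lt // -/(vx (num v)) vxK.
Qed.

Lemma input_cleE u v x y :
  input_cle I (num u) (num v) (num x) (num y) =
  (cost_of I (uv u v) <= cost_of I (uv x y))%R.
Proof.
rewrite /input_cle.
have E z : onth (enum V) (num z) = Some z.
  by rewrite onthE (nth_map x0) -?cardE ?num_lt // -/(vx _) vxK.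
by rewrite !E.
Qed.

Lemma input_total : \sum_(0 <= j < #|V|) input I 1 j = total_request I.
Proof. by rewrite sum_num; apply: eq_bigr => v _; apply: input_request. Qed.

End Numbering.

Section LoopBranch.

Variables (R : realFieldType) (V : finType) (x0 : V) (I : instance R V).
Local Notation n := #|V|.
Local Notation m := (agents I).
Local Notation den := (den (input_cle I)).

Definition loops_prog : fprog := owner_prog ;; output_prog loop_entry.

Lemma loops_outputs s :
  (forall a j, a \in [:: 0; 1] -> s a j = input I a j) ->
  (forall a j, a \in [:: 3; P4] -> s a j = 0) -> s 2 0 = 1 ->
  n < m -> m <= total_request I ->
  exists Xs : 'I_m -> multigraph V,
    outputs (I := I) (den loops_prog s) (Some Xs) /\ split_loops (I := I) Xs.
Proof.
move=> sI s0 s2 nm mr; have s00 : s 0 0 = n by rewrite sI.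
have s01 : s 0 1 = m by rewrite sI.
rewrite /loops_prog den_seq; set s1 := den owner_prog s.
have fr1 a j : a \notin writes owner_prog -> s1 a j = s a j by apply: den_frame.
have [] := @den_owner (input_cle I) s; rewrite ?s00 ?s01 -/s1 //.
- by rewrite (eq_bigr (input I 1)) ?(input_total x0) // => j _; rewrite sI.
- by move=> v vn; rewrite sI // -(numK x0 vn) (input_request x0) request_ge1.
move=> H1 H2 H3.
pose g i u v := if u == v then
    if s1 OWN i == u then if i == u then 1 + s1 REM u else 1 else 0 else 0.
have [||||A4 A3] := @den_output (input_cle I) loop_entry s1 g.
- by [].
- move=> s' fr _ _ _ b j; rewrite /loop_entry /g.
  rewrite !den_eq /= (fr OWN) //; case: (s' CU 0 == s' CV 0) => //.
  by case: (s1 OWN _ == _) => //; case: (_ == _); rewrite ?(fr REM).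
- by rewrite fr1 // s0.
- by move=> j; rewrite fr1 // s0.
rewrite !fr1 // s00 s01 in A4 A3.
pose k i (v : V) := if s1 OWN i == num v then
    if i == num v then 1 + s1 REM (num v) else 1 else 0.
pose Xs (i : 'I_m) : multigraph V :=
  [ffun e => \sum_v if e == loop v then k i v else 0].
have XsE i u v : Xs i (uv u v) = g i (num u) (num v).
  rewrite ffunE /g num_eq; have [<-|uv'] := eqVneq u v.
    rewrite (bigD1 u) //= eqxx big1 ?addn0 // => y; rewrite eq_loop eq_sym.
    by move=> /negPf->.
  rewrite big1 // => y _; rewrite eq_loop; case: eqP => // uy; case: eqP => // vy.
  by rewrite uy vy eqxx in uv'.
exists Xs; split.
  split=> [|u v|i u v].
  - by rewrite den_frame // fr1.
  - by rewrite A3 ?num_lt // ffunE big_mkord; apply: eq_bigr => i _; rewrite XsE.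
  - by rewrite A4 ?num_lt ?ltn_ord // XsE.
split=> [|i].
  apply/ffunP=> e; rewrite !ffunE.
  transitivity (\sum_(i < m) \sum_v if e == loop v then k i v else 0).
    by apply: eq_bigr => i _; rewrite ffunE.
  rewrite exchange_big; apply: eq_bigr => v _ /=; case: ifP => // _; last by rewrite big1.
  rewrite -(input_request x0) -sI // H3 ?num_lt // addnC big_mkord.
  (* The remainder at v goes to the agent with the number of v, which exists since n < m. *)
  have vm : num v < m by apply: ltn_trans nm; apply: num_lt.
  rewrite (bigD1 (Ordinal vm)) //= (bigD1 (Ordinal vm) (P := predT)) //=.
  rewrite /k /= H2 ?num_lt // !eqxx addnAC; congr (_ + _ + _).
  apply: eq_bigr => j; rewrite -val_eqE /= => /negPf->.
  by case: (_ == _).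
have on := H1 i (ltn_ord i); have onum : num (vx x0 (s1 OWN i)) = s1 OWN i by apply: numK.
split.
  exists (loop (vx x0 (s1 OWN i))); rewrite XsE /g eqxx onum eqxx.
  by case: eqP.
exists (vx x0 (s1 OWN i)) => e; rewrite ffunE lt0n sum_nat_eq0 negb_forall.
case/existsP=> v; rewrite implyTb; case: (eqVneq e (loop v)) => // -> /=; rewrite /k.
by case: (eqVneq (s1 OWN i) (num v)) => // E _; rewrite E vxK.
Qed.

End LoopBranch.

(** * Spanning forest and cycles *)

Definition lab_of (a : nat) : expr := Cell LAB (var a).

Definition forest_init : fprog :=
  FFor CV 0 (FAssign LAB (var CV) (var CV) ;; FAssign NEXT (var CV) (var CV)).

Definition take_pair : fprog := set_var BU (var CU) ;; set_var BV (var CV).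

(** Equal labels at [BU] and [BV] mean that no candidate is known, so no flag or reset is needed:
    initially both are 0, and a pair left over from an earlier round either has equal labels or is a
    genuine candidate. *)
Definition better_pair : fprog :=
  FIf (EqE (lab_of CU) (lab_of CV)) FSkip
    (FIf (EqE (lab_of BU) (lab_of BV)) take_pair
       (FIf (CostLe (var CU) (var CV) (var BU) (var BV)) take_pair FSkip)).

Definition search_prog : fprog := FFor CU 0 (FFor CV 0 better_pair).

(** The labels are saved first because merging overwrites the label of [BV] while later iterations
    still compare with it. *)
Definition record_prog : fprog :=
  FAssign EU (var CK) (var BU) ;; FAssign EV (var CK) (var BV) ;;
  set_var LU (lab_of BU) ;; set_var LV (lab_of BV).

Definition merge_prog : fprog :=
  FFor CW 0 (FIf (EqE (lab_of CW) (var LV)) (FAssign LAB (var CW) (var LU)) FSkip).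

Definition edge_prog : fprog := search_prog ;; record_prog ;; merge_prog.

Definition more_edges : expr := Op Add (var CK) (Cell 0 (Lit 1)).

(** Loops can only run to n or m, so the test makes the rounds after the first n - m idle. *)
Definition kruskal_prog : fprog :=
  FFor CK 0 (FIf (LtE more_edges (Cell 0 (Lit 0))) edge_prog FSkip).

(* Each component is represented by the vertex that is its own label. *)
Definition roots_prog : fprog :=
  FFor CV 0 (FIf (EqE (lab_of CV) (var CV))
    (FAssign PLACED (var CV) (Lit 1) ;; FAssign NUMBER (var CV) (var COUNT) ;;
     incr COUNT) FSkip).

(* Inserts the endpoint b after the endpoint a when only a is placed. *)
Definition attach_prog (a b : nat) : fprog :=
  FIf (Cell PLACED (Cell a (var CK)))
    (FIf (Cell PLACED (Cell b (var CK))) FSkip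
       (FAssign NEXT (Cell b (var CK)) (Cell NEXT (Cell a (var CK))) ;;
        FAssign NEXT (Cell a (var CK)) (Cell b (var CK)) ;;
        FAssign PLACED (Cell b (var CK)) (Lit 1)))
    FSkip.

Definition scan_prog : fprog :=
  FFor CK 0 (FIf (LtE more_edges (Cell 0 (Lit 0)))
    (attach_prog EU EV ;; attach_prog EV EU) FSkip).

Definition grow_prog : fprog := FFor CW 0 scan_prog.

Definition next_of (a : nat) : expr := Cell NEXT (var a).

Definition tree_entry : fprog :=
  FIf (EqE (Cell NUMBER (lab_of CU)) (var CI))
    (FIf (EqE (var CU) (var CV))
       (FAssign 4 (var P4) (Op Add (EqE (next_of CU) (var CU))
          (Op Defs.Sub (Cell 1 (var CU)) (Lit 1))))
       (FAssign 4 (var P4) (Op Add (EqE (next_of CU) (var CV))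
          (EqE (next_of CV) (var CU)))))
    (FAssign 4 (var P4) (Lit 0)).

Definition forest_prog : fprog :=
  forest_init ;; kruskal_prog ;; roots_prog ;; grow_prog ;; output_prog tree_entry.


(** * Correctness of the forest branch *)

Section ForestBranch.

Variables (R : realFieldType) (V : finType) (x0 : V) (I : instance R V).
Local Notation n := #|V|.
Local Notation m := (agents I).
Local Notation den := (den (input_cle I)).
Local Notation vx := (vx x0).
Implicit Types (s : memory) (lab : V -> V).

Definition represents (a : nat) (f : V -> V) s := forall v, s a (num v) = num (f v).

Lemma den_more p s k :
  s CK 0 = k -> s 0 0 = n -> s 0 1 = m ->
  den (FIf (LtE more_edges (Cell 0 (Lit 0))) p FSkip) s =
  if k + m < n then den p s else s.
Proof. by move=> ck s00 s01; rewrite den_lt /= ck s00 s01. Qed.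

Lemma leq_both (a b : nat) : (1 < (a <= b) + (b <= a)) = (a == b).
Proof. by rewrite eqn_leq; case: (a <= b); case: (b <= a). Qed.

Section Search.

Variable lab : V -> V.

(** [done] holds the pairs inspected so far; the candidate has to cross components only once some
    inspected pair does. *)
Definition searched (done : rel V) s := exists x y : V,
  [/\ s BU 0 = num x, s BV 0 = num y
    & forall u v, done u v -> lab u != lab v ->
        lab x != lab y /\ (cost_of I (uv x y) <= cost_of I (uv u v))%R].

Lemma searched_ext (d1 d2 : rel V) s1 s2 :
  (forall u v, d2 u v -> d1 u v) -> (forall a, a \in [:: BU; BV] -> s2 a 0 = s1 a 0) ->
  searched d1 s1 -> searched d2 s2.
Proof.
move=> dd E [x [y [Ex Ey min]]]; exists x, y; rewrite !E //.
by split=> // u v /dd; apply: min.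
Qed.

Lemma den_better_pair done s u v :
  represents LAB lab s -> s CU 0 = num u -> s CV 0 = num v -> searched done s ->
  searched (fun a b => done a b || (a == u) && (b == v)) (den better_pair s).
Proof.
move=> sl su sv [x [y [Ex Ey min]]]; rewrite /better_pair !den_eq /=.
rewrite su sv Ex Ey !sl !num_eq (input_cleE x0).
have [luv|luv] := eqVneq (lab u) (lab v).
  exists x, y; split=> // a b /orP[|/andP[/eqP-> /eqP->]]; first exact: min.
  by rewrite luv eqxx.
have [lxy|lxy] := eqVneq (lab x) (lab y).
  exists u, v; rewrite !updateE /=; split=> // a b /orP[dab lab'|/andP[/eqP-> /eqP->]] //.
  by have [] := min a b dab lab'; rewrite lxy eqxx.
case: (boolP (_ <= _)%R) => [le|]; rewrite ?eqb0 /=.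
  exists u, v; rewrite !updateE /=; split=> // a b /orP[dab lab'|/andP[/eqP-> /eqP->]] //.
  by have [_ le'] := min a b dab lab'; split=> //; apply: le_trans le'.
rewrite -ltNge => /ltW lt.
exists x, y; split=> // a b /orP[|/andP[/eqP-> /eqP->]]; first exact: min.
by [].
Qed.

Lemma den_search s (x1 y1 : V) :
  s 0 0 = n -> represents LAB lab s -> s BU 0 = num x1 -> s BV 0 = num y1 ->
  searched (fun _ _ => true) (den search_prog s).
Proof.
move=> s00 sl s1 s2.
pose J k s' := searched (fun u _ => num u < k) s'.
suff : J (s 0 0) (den search_prog s).
  by apply: searched_ext => // u v _; rewrite s00 num_lt.
apply: den_for => //; first by exists x1, y1; rewrite !updateE.
move=> k s' kn ck fr Jk; rewrite s00 in kn.
have n' : s' 0 0 = n by rewrite fr.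
pose Jv k' s'' := searched (fun u v => (num u < k) || (u == vx k) && (num v < k')) s''.
suff : Jv (s' 0 0) (den (FFor CV 0 better_pair) s').
  rewrite n'; apply: searched_ext => [u v|a].
    by rewrite (num_ltS x0) // num_lt andbT orbC.
  by rewrite /tick updateE !inE => /orP[] /eqP->.
apply: den_for => //.
  apply: searched_ext Jk => [u v|a]; first by rewrite ltn0 andbF orbF.
  by rewrite updateE !inE => /orP[] /eqP->.
move=> k' s'' kn' ck' fr' Jk'; rewrite n' in kn'.
have sl'' : represents LAB lab s'' by move=> v; rewrite fr' // fr.
have := den_better_pair (u := vx k) (v := vx k') sl'' _ _ Jk'.
rewrite fr' // ck ck' !numK // => /(_ erefl erefl).
apply: searched_ext => [u v|a].
  rewrite (num_ltS x0 v) //; case: (num u < k) => //=.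
  by case: (u == vx k) => //=; rewrite orbC.
by rewrite /tick updateE !inE => /orP[] /eqP->.
Qed.

Lemma den_merge s (x y : V) :
  s 0 0 = n -> represents LAB lab s -> s LU 0 = num (lab x) -> s LV 0 = num (lab y) ->
  represents LAB (fun u => if lab u == lab y then lab x else lab u) (den merge_prog s).
Proof.
move=> s00 sl su sv; set lab' := fun u => _.
pose J k s' := forall u, s' LAB (num u) = num (if num u < k then lab' u else lab u).
suff H : J (s 0 0) (den merge_prog s) by move=> u; rewrite H s00 num_lt.
apply: den_for => [||k s' kn ck fr Jk u] //.
rewrite s00 in kn; rewrite (num_ltS x0) // /tick den_eq updateE /= ck.
rewrite -(numK x0 kn) Jk fr // sv num_eq numK // ltnn.
have [->|uk] := eqVneq u (vx k).
  rewrite /lab'; case: ifP => E /=; first by rewrite updateE /= numK // eqxx fr.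
  by rewrite Jk numK // ltnn.
have ne : (num u == k) = false by rewrite -(numK x0 kn) num_eq; apply/negbTE.
by case: ifP => _ /=; rewrite ?updateE /= ?ne /= Jk.
Qed.

End Search.

Definition edge_at s j : edge V := uv (vx (s EU j)) (vx (s EV j)).

Definition kruskal_inv k (F : {set edge V}) lab s : Prop :=
  [/\ [/\ greedy_opt I (n - k) F, labels F lab & forall v, lab (lab v) = lab v],
      represents LAB lab s,
      exists x y : V, s BU 0 = num x /\ s BV 0 = num y,
      forall j, j < k -> [/\ s EU j < n, s EV j < n & edge_at s j \in F]
    & forall e, e \in F -> exists2 j, j < k & e = edge_at s j].

Lemma kruskal_inv_ext k F lab s1 s2 :
  (forall a j, a \in [:: LAB; BU; BV; EU; EV] -> s2 a j = s1 a j) ->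
  kruskal_inv k F lab s1 -> kruskal_inv k F lab s2.
Proof.
move=> E [optF sl [x [y [sx sy]]] eF Fe]; split=> //.
- by move=> v; rewrite E.
- by exists x, y; rewrite !E.
- by move=> j /eF; rewrite /edge_at !E.
by move=> e /Fe[j jk ->]; exists j; rewrite // /edge_at !E.
Qed.

Lemma den_edge k F lab s :
  k < n - m -> s 0 0 = n -> s CK 0 = k -> kruskal_inv k F lab s ->
  exists F' lab', kruskal_inv k.+1 F' lab' (den edge_prog s).
Proof.
move=> km s00 ck [[optF labF idem] sl [x1 [y1 [sx1 sy1]]] eF Fe].
have m1 := agents_ge1 I.
rewrite /edge_prog den_seq.
have fr2 a j : a \notin writes search_prog -> den search_prog s a j = s a j.
  exact: den_frame.
have [x [y]] := den_search s00 sl sx1 sy1.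
set s2 := den search_prog s in fr2 *; case=> sx sy min.
have [cF _ _] := optF.
(* There are n - k > m >= 1 components, so some pair crosses and the search has found a
   candidate. *)
have /card_gt1P[_ [_ [/imsetP[x' _ ->] /imsetP[y' _ ->] lxy']]] :
    1 < #|lab @: [set: V]|.
  by rewrite -(card_labels labF) cF; lia.
have [lxy _] := min _ _ isT lxy'.
have {}min u v : lab u != lab v -> (cost_of I (uv x y) <= cost_of I (uv u v))%R.
  by move=> luv; have [] := min _ _ isT luv.
rewrite den_seq; set s3 := den record_prog s2.
have sl2 : represents LAB lab s2 by move=> v; rewrite fr2.
have E3 b j : s3 b j =
    if (b == LV) && (j == 0) then num (lab y) else
    if (b == LU) && (j == 0) then num (lab x) else
    if (b == EV) && (j == k) then num y else
    if (b == EU) && (j == k) then num x else s2 b j.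
  have cs2 : s2 CK 0 = k by rewrite fr2.
  by rewrite /s3 /= !updateE /= sx sy cs2 !sl2.
have sl3 : represents LAB lab s3 by move=> v; rewrite E3 /= sl2.
have n3 : s3 0 0 = n by rewrite E3 /= fr2.
have lu : s3 LU 0 = num (lab x) by rewrite E3.
have lv : s3 LV 0 = num (lab y) by rewrite E3.
have := den_merge n3 sl3 lu lv.
set lab' := fun u => _; set s4 := den merge_prog s3 => sl4.
have fr4 a j : a \notin writes merge_prog -> s4 a j = s3 a j by apply: den_frame.
have edge_k : edge_at s4 k = uv x y.
  by rewrite /edge_at !fr4 // !E3 /= eqxx !vxK.
have edge_j j : j < k -> edge_at s4 j = edge_at s j.
  by move=> jk; rewrite /edge_at !fr4 // !E3 /= !(ltn_eqF jk) /= !fr2.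
exists (uv x y |: F), lab'; split=> //.
- split; last first.
  + move=> v; rewrite /lab'; have [_|ne] := eqVneq (lab v) (lab y).
      by rewrite idem (negPf lxy).
    by rewrite idem (negPf ne).
  + exact: labels_merge.
  apply: greedy_opt_step labF lxy min.
  by rewrite -subSn ?subSS //; lia.
- by exists x, y; rewrite !fr4 // !E3.
- move=> j; rewrite ltnS leq_eqVlt => /orP[/eqP->|jk].
    by rewrite edge_k setU11 !fr4 // !E3 /= eqxx !num_lt.
  rewrite edge_j // !fr4 // !E3 /= !(ltn_eqF jk) /= !fr2 //.
  by have [-> -> jF] := eF j jk; rewrite setU1r.
move=> e; rewrite in_setU1 => /orP[/eqP->|/Fe[j jk ->]].
  by exists k; rewrite ?edge_k.
by exists j; rewrite ?edge_j // ltnW.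
Qed.

Lemma den_kruskal s :
  m <= n -> s 0 0 = n -> s 0 1 = m -> represents LAB id s ->
  s BU 0 = 0 -> s BV 0 = 0 ->
  exists F lab, kruskal_inv (n - m) F lab (den kruskal_prog s).
Proof.
move=> mn s00 s01 sl bu bv.
(* The minimum freezes the invariant during the idle rounds. *)
pose J k s' := exists F lab, kruskal_inv (minn k (n - m)) F lab s'.
suff : J (s 0 0) (den kruskal_prog s).
  by rewrite /J s00 (minn_idPr _) // leq_subr.
apply: den_for => //.
  exists set0, id; rewrite min0n; split=> //.
  - by rewrite subn0; split=> //; [apply: greedy_opt0 | apply: labels0].
  - have n0 : 0 < n by apply: leq_trans mn; apply: agents_ge1.
    by exists (vx 0), (vx 0); rewrite !updateE /= numK // bu bv.
  - by move=> e; rewrite inE.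
move=> k s' kn ck fr [F [lab inv]]; rewrite s00 in kn.
have tickE s'' F' lab' k' : kruskal_inv k' F' lab' s'' -> kruskal_inv k' F' lab' (tick CK s'').
  apply: kruskal_inv_ext => a j; rewrite /tick updateE !inE.
  by do 4! case/orP => [/eqP->//|]; move=> /eqP->.
rewrite (den_more _ ck) ?fr //.
case: ltnP => km; last first.
  exists F, lab; apply: tickE.
  by have -> : minn k.+1 (n - m) = minn k (n - m) by lia.
have km' : k < n - m by lia.
rewrite (minn_idPl (ltnW km')) in inv.
have n' : s' 0 0 = n by rewrite fr.
have [F' [lab' inv']] := den_edge km' n' ck inv.
by exists F', lab'; apply: tickE; rewrite (minn_idPl km').
Qed.

Lemma den_forest_init s :
  s 0 0 = n -> represents LAB id (den forest_init s) /\ represents NEXT id (den forest_init s).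
Proof.
move=> s00; pose J k s' := forall u : V, num u < k ->
  s' LAB (num u) = num u /\ s' NEXT (num u) = num u.
suff H : J (s 0 0) (den forest_init s) by split=> u; have [] := H u; rewrite // s00 num_lt.
apply: den_for => // k s' kn ck fr Jk u.
rewrite s00 in kn; rewrite (num_ltS x0) // /tick /= !updateE /= ck.
have [->|ne] /= := eqVneq u (vx k); first by rewrite numK // eqxx.
rewrite -(numK x0 kn) num_eq (negPf ne) numK //; exact: Jk.
Qed.

Section Grow.

Variables (F : {set edge V}) (lab : V -> V).
Hypotheses (labF : labels F lab) (lab_idem : forall v, lab (lab v) = lab v).
Hypothesis cardF : #|F| + #|components F| = #|V|.

(** Counting the roots before v, as [COUNT] does, numbers the components injectively from 0. *)
Definition root_rank (v : V) := #|[set w | (lab w == w) && (num w < num v)]|.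

Lemma den_roots s :
  s 0 0 = n -> represents LAB lab s -> (forall j, s PLACED j = 0) -> s COUNT 0 = 0 ->
  let s' := den roots_prog s in
  (forall v, s' PLACED (num v) = (lab v == v)) /\
  (forall v, lab v = v -> s' NUMBER (num v) = root_rank v).
Proof.
move=> s00 sl p0 c0; cbv zeta.
pose J k s' := [/\ s' COUNT 0 = #|[set w | (lab w == w) && (num w < k)]|,
  forall v, s' PLACED (num v) = (num v < k) && (lab v == v)
  & forall v, num v < k -> lab v = v -> s' NUMBER (num v) = root_rank v].
suff [_ H1 H2] : J (s 0 0) (den roots_prog s).
  by split=> v; [rewrite H1 | move=> lv; rewrite H2 //]; rewrite s00 num_lt.
apply: den_for => //.
  split=> [|v|//]; last by rewrite updateE /= p0.
  rewrite updateE /= c0; apply/esym/eqP; rewrite cards_eq0; apply/eqP/setP=> w.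
  by rewrite !inE ltn0 andbF.
move=> k s' kn ck fr [J1 J2 J3]; rewrite s00 in kn.
have setS : [set w | (lab w == w) && (num w < k.+1)] =
   if lab (vx k) == vx k then vx k |: [set w | (lab w == w) && (num w < k)]
   else [set w | (lab w == w) && (num w < k)].
  apply/setP=> w; rewrite inE (num_ltS x0) //; case: ifP => lk; rewrite !inE.
    by have [->|] := eqVneq w (vx k); rewrite ?lk.
  by have [->|] := eqVneq w (vx k); rewrite ?lk.
rewrite den_eq /= ck -(numK x0 kn) fr // sl num_eq numK // /J setS.
case: ifP => lk.
  split=> [|v|v].
  - by rewrite /tick /= !updateE /= J1 cardsU1 !inE numK // ltnn andbF addn1.
  - rewrite /tick !updateE /= (num_ltS x0) // (eq_sym (num v)) -(eq_vx x0 v kn) eq_sym J2.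
    by have [->|] := eqVneq v (vx k); rewrite ?lk.
  rewrite /tick !updateE /= ck (num_ltS x0) // (eq_sym (num v)) -(eq_vx x0 v kn) eq_sym.
  have [-> _ _|ne /= vk lv] := eqVneq v (vx k); last by rewrite J3.
  by rewrite J1 /root_rank numK.
split=> [|v|v].
- by rewrite /tick updateE.
- rewrite /tick updateE /= J2 (num_ltS x0) //.
  by have [->|] := eqVneq v (vx k); rewrite ?lk ?andbF.
rewrite /tick updateE /= (num_ltS x0) //.
by have [->|ne] := eqVneq v (vx k); [move=> _ E; rewrite E eqxx in lk | apply: J3].
Qed.

Definition growing (P : {set V}) nxt s :=
  [/\ represents NEXT nxt s, forall v, s PLACED (num v) = (v \in P) & grown F lab P nxt].

Lemma growing_ext P nxt s1 s2 :
  (forall a j, a \in [:: NEXT; PLACED] -> s2 a j = s1 a j) ->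
  growing P nxt s1 -> growing P nxt s2.
Proof. by move=> E [sn sp gP]; split=> // v; rewrite E. Qed.

Lemma den_attach a b s P nxt u v :
  s a (s CK 0) = num u -> s b (s CK 0) = num v -> a \notin [:: NEXT; PLACED] ->
  b \notin [:: NEXT; PLACED] -> uv u v \in F -> growing P nxt s ->
  exists P' nxt', [/\ growing P' nxt' (den (attach_prog a b) s), P \subset P'
    & u \in P -> v \in P'].
Proof.
move=> su sv aN bN Fuv [sn sp gP]; rewrite /attach_prog /= su sv !sp !eqb0 !negbK.
have [uP|uP] := boolP (u \in P); last by exists P, nxt; split.
have [vP|vP] := boolP (v \in P); first by exists P, nxt; split.
exists (v |: P), (insert_next nxt u v); split; rewrite ?subsetUr ?setU11 //.
have aE : (a == NEXT) = false by move: aN; rewrite !inE negb_or => /andP[/negPf].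
have bE : (b == NEXT) = false by move: bN; rewrite !inE negb_or => /andP[/negPf].
split; last exact: grown_insert.
  move=> w; rewrite !updateE /= ?aE ?bE /= ?su ?sv !num_eq sn.
  rewrite /insert_next; have [_|wu] := eqVneq w u; first by [].
  by have [_|wv] := eqVneq w v.
move=> w; rewrite !updateE /= ?aE ?bE /= ?su ?sv !num_eq in_setU1 sp.
by case: (eqVneq w v).
Qed.

Definition edges_listed s := 
  (forall j, j < n - m -> [/\ s EU j < n, s EV j < n & edge_at s j \in F]) /\
  (forall e, e \in F -> exists2 j, j < n - m & e = edge_at s j).

(** Closure is relative to the set at the start of the scan: vertices placed meanwhile may have
    unplaced neighbours, but a scan that places nothing proves its set closed. *)
Lemma den_scan s P0 nxt0 :
  s 0 0 = n -> s 0 1 = m -> edges_listed s -> growing P0 nxt0 s ->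
  exists P nxt, [/\ growing P nxt (den scan_prog s), P0 \subset P
    & forall u v, uv u v \in F -> u \in P0 -> v \in P].
Proof.
move=> s00 s01 [eF Fe] g0.
pose J k s' := exists P nxt, [/\ growing P nxt s', P0 \subset P
  & forall j, j < k -> j < n - m -> (vx (s EU j) \in P0 -> vx (s EV j) \in P) /\
      (vx (s EV j) \in P0 -> vx (s EU j) \in P)].
suff [P [nxt [gP sub cl]]] : J (s 0 0) (den scan_prog s).
  exists P, nxt; split=> // u v /Fe[j jm /eqP]; rewrite uv_eq.
  have [|clu clv] := cl j _ jm; first by rewrite s00; lia.
  by case/orP => /andP[/eqP-> /eqP->].
apply: den_for => //.
  by exists P0, nxt0.
move=> k s' kn ck fr [P [nxt [gP sub cl]]]; rewrite s00 in kn.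
have tickE s'' P' nxt' : growing P' nxt' s'' -> growing P' nxt' (tick CK s'').
  apply: growing_ext => a j; rewrite /tick updateE !inE.
  by case/orP => /eqP->.
rewrite (den_more _ ck) ?fr //.
case: ltnP => km; last first.
  by exists P, nxt; split=> // j _ jm; apply: cl => //; lia.
have km' : k < n - m by lia.
have [un vn eFk] := eF k km'.
have at1 : s' EU (s' CK 0) = num (vx (s EU k)) by rewrite ck fr // numK.
have at2 : s' EV (s' CK 0) = num (vx (s EV k)) by rewrite ck fr // numK.
have [//|//|P1 [nxt1 [g1 sub1 in1]]] := den_attach at1 at2 _ _ eFk gP.
set s1 := den (attach_prog EU EV) s' in g1 *.
have fr1 a j : a \notin writes (attach_prog EU EV) -> s1 a j = s' a j by apply: den_frame.
have at1' : s1 EU (s1 CK 0) = num (vx (s EU k)) by rewrite !fr1.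
have at2' : s1 EV (s1 CK 0) = num (vx (s EV k)) by rewrite !fr1.
rewrite /edge_at uvC in eFk.
have [//|//|P2 [nxt2 [g2 sub2 in2]]] := den_attach at2' at1' _ _ eFk g1.
exists P2, nxt2; split; first exact: tickE.
  exact: subset_trans sub (subset_trans sub1 sub2).
move=> j; rewrite ltnS leq_eqVlt => /orP[/eqP-> _|jk jm].
  split=> xP; first by apply/(subsetP sub2)/in1/(subsetP sub).
  by apply/in2/(subsetP sub1)/(subsetP sub).
have [c1 c2] := cl j jk jm.
by split=> xP; apply/(subsetP sub2)/(subsetP sub1); [apply: c1 | apply: c2].
Qed.

Lemma edges_listed_ext s1 s2 :
  (forall a j, a \in [:: EU; EV] -> s2 a j = s1 a j) ->
  edges_listed s1 -> edges_listed s2.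
Proof.
move=> E [eF Fe]; split=> [j /eF|e /Fe[j jm ->]].
  by rewrite /edge_at !E.
by exists j; rewrite // /edge_at !E.
Qed.

(** Each scan places a further vertex unless its set is closed under F, hence everything by
    [grown_full]; so n scans suffice. *)
Lemma den_grow s P0 nxt0 :
  s 0 0 = n -> s 0 1 = m -> edges_listed s -> growing P0 nxt0 s ->
  exists nxt, growing setT nxt (den grow_prog s).
Proof.
move=> s00 s01 eL g0.
pose J k s' := exists P nxt, growing P nxt s' /\ k <= #|P|.
suff [P [nxt [gP]]] : J (s 0 0) (den grow_prog s).
  rewrite s00 => nP; exists nxt; suff <- : P = setT by [].
  by apply/eqP; rewrite eqEcard subsetT cardsT nP.
apply: den_for => //.
  by exists P0, nxt0.
move=> k s' kn ck fr [P [nxt [gP kP]]]; rewrite s00 in kn.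
have [|||P' [nxt' [gP' sub cl]]] := @den_scan s' P nxt _ _ _ gP; rewrite ?fr //.
  by apply: edges_listed_ext eL => a j; rewrite !inE => /orP[] /eqP->; rewrite fr.
exists P', nxt'; split.
  apply: growing_ext gP' => a j; rewrite /tick updateE !inE.
  by case/orP => /eqP->.
rewrite ltnNge; apply/negP => P'k.
have EP : P = P' by apply/eqP; rewrite eqEcard sub (leq_trans P'k).
have [_ _ gr] := gP; have PT : P = setT.
  by apply: (grown_full labF lab_idem gr) => u v; rewrite {2}EP; apply: cl.
by move: P'k; rewrite -EP PT cardsT leqNgt kn.
Qed.

Lemma root_rank_lt v : lab v = v -> root_rank v < #|components F|.
Proof.
move=> lv; rewrite (card_labels labF).
have -> : lab @: [set: V] = [set w | lab w == w].
  apply/setP=> w; rewrite inE; apply/imsetP/eqP => [[x _ ->]|<-]; first exact: lab_idem.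
  by exists w.
apply: proper_card; apply/properP; split.
  by apply/subsetP=> w; rewrite !inE => /andP[].
by exists v; rewrite !inE ?lv ?eqxx // ltnn.
Qed.

Lemma root_rank_mono u v : lab u = u -> num u < num v -> root_rank u < root_rank v.
Proof.
move=> lu uv0; apply: proper_card; apply/properP; split.
  apply/subsetP=> w; rewrite !inE => /andP[-> wu]; exact: ltn_trans uv0.
by exists u; rewrite !inE ?lu ?eqxx ?uv0 // ltnn.
Qed.

Lemma root_rank_inj u v :
  (root_rank (lab u) == root_rank (lab v)) = (lab u == lab v).
Proof.
apply/eqP/eqP => [E|-> //]; apply/eqP; rewrite -num_eq.
by case: ltngtP => // /root_rank_mono; rewrite lab_idem E ltnn => /(_ erefl).
Qed.

End Grow.

Lemma forest_outputs s :
  (forall a j, a \in [:: 0; 1] -> s a j = input I a j) ->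
  (forall a j, a \in [:: 3; BU; BV; PLACED; COUNT; P4] -> s a j = 0) -> s 2 0 = 1 ->
  m <= n -> m <= total_request I ->
  exists out : outcome I, outputs (den forest_prog s) out /\ algorithm out.
Proof.
move=> sI s0 s2 mn mr; have s00 : s 0 0 = n by rewrite sI.
have s01 : s 0 1 = m by rewrite sI.
rewrite /forest_prog den_seq.
have fr1 a j : a \notin writes forest_init -> den forest_init s a j = s a j.
  exact: den_frame.
have [l1 n1] := den_forest_init s00; set s1 := den forest_init s in fr1 l1 n1 *.
rewrite den_seq.
have fr2 a j : a \notin writes kruskal_prog -> den kruskal_prog s1 a j = s1 a j.
  exact: den_frame.
have [||||F [lab [[optF labF idem] l2 _ eF Fe]]] := den_kruskal mn _ _ l1 _ _.
1-4: by rewrite fr1 // s0.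
set s2' := den kruskal_prog s1 in fr2 l2 eF Fe *.
rewrite (subKn mn) in optF; have [cF sF _] := optF.
have cardF : #|F| + #|components F| = n by rewrite cF.
rewrite den_seq.
have fr3 a j : a \notin writes roots_prog -> den roots_prog s2' a j = s2' a j.
  exact: den_frame.
have [|||p3 q3] := @den_roots lab s2' _ l2 _ _.
- by rewrite fr2 ?fr1.
- by move=> j; rewrite fr2 // fr1 // s0.
- by rewrite fr2 // fr1 // s0.
set s3 := den roots_prog s2' in fr3 p3 q3 *.
rewrite den_seq.
have fr4 a j : a \notin writes grow_prog -> den grow_prog s3 a j = s3 a j.
  exact: den_frame.
have g3 : growing F lab [set v | lab v == v] id s3.
  split=> [v|v|]; last exact: grown_roots.
    by rewrite fr3 // fr2 // n1.
  by rewrite p3 inE.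
have [|||nxt [n4 _ g4]] := @den_grow F lab labF idem cardF s3 _ _ _ _ _ g3.
- by rewrite fr3 // fr2 // fr1.
- by rewrite fr3 // fr2 // fr1.
- split=> [j /eF|e /Fe[j jm ->]]; first by rewrite /edge_at !fr3.
  by exists j; rewrite // /edge_at !fr3.
set s4 := den grow_prog s3 in fr4 n4 *.
pose idx v := root_rank lab (lab v).
have idx_lt v : idx v < m by rewrite -cF; apply: root_rank_lt.
have idx_inj u v : (idx u == idx v) = (lab u == lab v) by apply: root_rank_inj.
(* Numbers are stored at roots only, hence the access through the label of v. *)
have num4 v : s4 NUMBER (s4 LAB (num v)) = idx v.
  by rewrite (fr4 NUMBER) // (fr4 LAB) // (fr3 LAB) // l2 q3 // idem.
pose X := add_loops (I := I) (fun i : 'I_m => [ffun e =>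
    \sum_(x in [set v | idx v == i]) (uv x (nxt x) == e)]) (fun v => Ordinal (idx_lt v)).
have XE i u v := outcome_edge labF idem optF g4 idx_lt idx_inj i u v.
pose g i u v := if idx (vx u) == i then
    if u == v then (num (nxt (vx u)) == u) + (request I (vx u) - 1)
    else (num (nxt (vx u)) == v) + (num (nxt (vx v)) == u) else 0.
have gE (i : 'I_m) u v : X i (uv u v) = g i (num u) (num v).
  by rewrite XE /g !vxK !num_eq.
have s40 : s4 0 0 = n by rewrite fr4 // fr3 // fr2 // fr1.
have s41 : s4 0 1 = m by rewrite fr4 // fr3 // fr2 // fr1.
have [||||A4 A3] := @den_output (input_cle I) tree_entry s4 g.
- by [].
- move=> s' fr un vn im b j; rewrite s40 in un vn.
  have [u eu] : exists u : V, s' CU 0 = num u by exists (vx (s' CU 0)); rewrite numK.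
  have [v ev] : exists v : V, s' CV 0 = num v by exists (vx (s' CV 0)); rewrite numK.
  have ru : s4 1 (num u) = request I u.
    by rewrite fr4 // fr3 // fr2 // fr1 // sI // (input_request x0).
  rewrite /tree_entry !den_eq /= eu ev !leq_both (fr NUMBER) // (fr LAB) // num4.
  rewrite !(fr NEXT) // (fr 1) // !n4 ru /g !vxK.
  by case: (idx u == _) => //; case: (num u == num v).
- by rewrite fr4 // fr3 // fr2 // fr1 // s0.
- by move=> j; rewrite fr4 // fr3 // fr2 // fr1 // s0.
rewrite s40 s41 in A4 A3; exists (Some X); split; last exact: algorithm_outcome.
split=> [|u v|i u v].
- by rewrite den_frame // fr4 // fr3 // fr2 // fr1.
- rewrite A3 ?num_lt // [munion _ _]ffunE big_mkord.
  by apply: eq_bigr => i _; rewrite gE.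
by rewrite A4 ?num_lt ?ltn_ord // gE.
Qed.

End ForestBranch.

(** * The complete program and its running time *)

Definition main_prog : fprog :=
  sum_prog ;;
  FIf (Op Leq (Cell 0 (Lit 1)) (var TOT))
    (FAssign 2 (Lit 0) (Lit 1) ;;
     FIf (Op Leq (Cell 0 (Lit 1)) (Cell 0 (Lit 0))) forest_prog loops_prog)
    FSkip.

Section Main.

Variables (R : realFieldType) (V : finType) (I : instance R V).
Local Notation n := #|V|.
Local Notation m := (agents I).

Lemma main_outputs :
  exists out : outcome I, outputs (den (input_cle I) main_prog (input I)) out /\ algorithm out.
Proof.
rewrite /main_prog den_seq; set s1 := den _ sum_prog _.
have fr1 a j : a \notin writes sum_prog -> s1 a j = input I a j by apply: den_frame.
have den_if e p q s : den (input_cle I) (FIf e p q) s =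
    if eval (input_cle I) s e != 0 then den (input_cle I) p s else den (input_cle I) q s by [].
rewrite den_if; have -> : eval (input_cle I) s1 (Op Leq (Cell 0 (Lit 1)) (var TOT)) =
    (m <= s1 TOT 0) by rewrite /= fr1.
(* Without vertices there is no default [x0]; the total request is then 0 < m and the answer is
   NO. *)
have [x0 _|V0] := pickP V; last first.
  have t0 : total_request I = 0 by apply: big_pred0.
  have -> : s1 TOT 0 = 0.
    by rewrite /s1 den_sum // big_geq //= (eq_card0 V0).
  rewrite leqNgt agents_ge1 /=; exists None; split; first by rewrite /= fr1.
  by apply: Alg_no; rewrite t0 agents_ge1.
have tot : s1 TOT 0 = total_request I by rewrite /s1 den_sum // (input_total x0).
rewrite tot eqb0 negbK; case: leqP => mr; last first.
  exists None; split; first by rewrite /= fr1.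
  exact: Alg_no.
rewrite den_seq den_if; set s2 := den _ (FAssign _ _ _) _.
have s2E a j : a != 2 -> a \notin writes sum_prog -> s2 a j = input I a j.
  by move=> a2 aw; rewrite /s2 /= updateE (negPf a2) fr1.
have -> : eval (input_cle I) s2 (Op Leq (Cell 0 (Lit 1)) (Cell 0 (Lit 0))) = (m <= n).
  by rewrite /= !s2E.
have sI a j : a \in [:: 0; 1] -> s2 a j = input I a j.
  by rewrite !inE => /orP[] /eqP->; rewrite s2E.
rewrite eqb0 negbK; case: leqP => mn.
  apply: (forest_outputs x0) => // a j; rewrite !inE.
  by do 5! [case/orP => [/eqP->|]; first by rewrite s2E]; move=> /eqP->; rewrite s2E.
have [|//|Xs [outXs spl]] := @loops_outputs R V x0 I s2 sI _ _ mn mr.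
  by move=> a j; rewrite !inE => /orP[] /eqP->; rewrite s2E.
by exists (Some Xs); split=> //; apply: Alg_loops.
Qed.

(** Lengths of n and m are bounded crudely by their values plus one; a request is at most r(V), so
    its length is logarithmic in r(V). *)
Lemma bounded_input : bounded (input I) (n + m + trunc_log 2 (total_request I) + 1).
Proof.
have b k : k <= n + m -> blen k <= n + m + trunc_log 2 (total_request I) + 1.
  by move=> km; apply: leq_trans (leq_blen km) _; apply: leq_trans (blen_self _) _; lia.
case=> [|[|a]] i; last by apply: (b 0).
  by case: i => [|[|i]] /=; apply: b; rewrite ?nth_nil ?leq_addr ?leq_addl.
apply: leq_trans (_ : blen (total_request I) <= _); last by rewrite /blen; lia.
  apply: leq_blen; have [ni|ni] := ltnP i (size (enum V)); last first.
    by rewrite /= nth_default // size_map.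
  have [x0 _|V0] := pickP V; last by move: ni; rewrite -cardE (eq_card0 V0).
  by rewrite /= (nth_map x0) // /total_request (bigD1 (nth x0 (enum V) i)) //= leq_addr.
Qed.

End Main.

Local Open Scope ring_scope.

Theorem theorem3p5 :
  (forall (R : realFieldType) (V : finType) (I : instance R V)
     (out : outcome I),
     algorithm out -> approximates 4 out) /\
  (exists (P : prog) (K d : nat),
     forall (R : realFieldType) (V : finType) (I : instance R V),
       exists (t : nat) (s : memory) (out : outcome I),
         [/\ exec (input_cle I) P (input I) t s,
             (t <= K * (#|V| + agents I + trunc_log 2 (total_request I)) ^ d)%N,
             outputs s out
           & algorithm out]).
Proof.
split; first exact: algorithm_approximates.
have [K [d time]] : exists K d, poly_time main_prog K d by apply: poly_time_ex.
(* For L = n + m + log r(V) the bounds are N = n + m and B = L + 1, and N + B <= 3 L since m >= 1;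
   hence the factor [3 ^ d]. *)
exists (compile main_prog), (K * 3 ^ d)%N, d => R V I.
have m1 := agents_ge1 I.
have [|||[t E T] _] :=
  time (input_cle I) (input I) (#|V| + agents I)%N _ _ _ _ (bounded_input I).
- by rewrite addn_gt0 m1 orbT.
- exact: leq_addr.
- exact: leq_addl.
have [out [outE alg]] := main_outputs I.
exists t, (den (input_cle I) main_prog (input I)), out; split=> //.
apply: leq_trans T _; rewrite -mulnA leq_mul2l -expnMn leq_exp2rW ?orbT //.
by lia.
Qed.
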